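(* Suppose that: (B1) $(X,\mathcal A,\mu)$ is a $\sigma$-finite measure space with $\mu(X)=\infty$, $Y\in\mathcal A$, $\mu(Y)\in(0,\infty)$, and $T$ is a CEMPT on $(X,\mathcal A,\mu)$. (B2) $w_n^Y\sim n^{1-\alpha}\ell(n)$ $(n\to\infty)$ for some $\alpha\in(0,1)$ and some positive, measurable function $\ell:(0,\infty)\to(0,\infty)$ slowly varying at $\infty$. (B3) The sequence $\Big\{\frac{1}{w_n^Y}\sum_{k=0}^{n-1}\hat T^k1_{Y_k}\Big\}_{n\ge1}$ is bounded in $L^\infty(\mu)$. For $t>0$ set $$a(t)=\frac{t}{\Gamma(1+\alpha)\,Q^Y(t^{-1})}\ \sim\ \frac{t^\alpha}{\Gamma(1+\alpha)\Gamma(2-\alpha)\ell(t)}\qquad(t\to\infty).$$ Let $\{\tilde c(n)\}_{n\ge0}$ be a positive-valued sequence satisfying $\tilde c(n)\to0$ and $\tilde c(n)a(n)\to\infty$ $(n\to\infty)$. Then $$\mu_{1_Y}\Big(\frac{S_n^Y}{a(n)}\le\tilde c(n)\Big)\sim\frac{\sin(\pi\alpha)}{\pi\alpha}\,\tilde c(n)\qquad(n\to\infty).$$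
   Context: $\mathbb N=\{1,2,\dots\}$, $\mathbb N_0=\mathbb N\cup\{0\}$. A measurable map $T:X\to X$ is a CEMPT on a $\sigma$-finite measure space $(X,\mathcal A,\mu)$ with $\mu(X)=\infty$ if it is a conservative, ergodic, measure-preserving transformation. For $0\le u\in L^1(\mu)$, $\mu_u(A)=\int_A u\,d\mu$ $(A\in\mathcal A)$ (so $\mu_{1_Y}(A)=\mu(A\cap Y)$); $\mu_u(\text{condition})$ denotes the $\mu_u$-measure of the set of $x\in X$ satisfying the condition. The transfer operator $\hat T:L^1(\mu)\to L^1(\mu)$ is characterized by $\int_X (v\circ T)u\,d\mu=\int_X v\,(\hat Tu)\,d\mu$ for all $v\in L^\infty(\mu)$, $u\in L^1(\mu)$ (and is extended to all non-negative measurable functions). For positive functions or sequences, $f\sim g$ means $f/g\to1$. A positive measurable $\ell:(0,\infty)\to(0,\infty)$ is slowly varying at $\infty$ if $\ell(\lambda t)\sim\ell(t)$ $(t\to\infty)$ for every $\lambda>0$. $\Gamma$ is the gamma function. First return time: $\varphi(x)=\min\{k\ge1: T^kx\in Y\}$ ($\min\emptyset=\infty$). Set $Y_0=Y$, $Y_n=Y^c\cap\{\varphi=n\}$ $(n\in\mathbb N)$. Wandering rate: $w_n^Y=\mu\big(\bigcup_{k=0}^{n-1}T^{-k}Y\big)=\sum_{k=0}^{n-1}\mu(Y_k)$. For $s>0$, $Q^Y(s)=\sum_{n\ge0}e^{-ns}(w_{n+1}^Y-w_n^Y)=\sum_{n\ge0}e^{-ns}\mu(Y\cap\{\varphi>n\})$.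 Occupation time: $S_n^Y(x)=\sum_{k=1}^n1_Y(T^kx)$. *)

(* Defs.v *)
From HB Require Import structures.
From mathcomp Require Import all_boot all_order all_algebra.
From mathcomp Require Import all_classical all_reals all_analysis.

Set Implicit Arguments.
Unset Strict Implicit.
Unset Printing Implicit Defensive.

Import Order.TTheory GRing.Theory Num.Theory.
Import numFieldNormedType.Exports.

Local Open Scope classical_set_scope.
Local Open Scope ring_scope.

Definition asymp_equiv {R : realType} {I : Type} (F : set_system I)
    (f g : I -> R) : Prop :=
  (f i / g i) @[i --> F] --> (1 : R).

(* Only the values of [ell] on ]0, +oo[ matter. *)
Record slowly_varying {R : realType} (ell : R -> R) : Prop := SlowlyVarying {
  slowly_varying_gt0 : forall t : R, 0 < t -> 0 < ell t ;
  slowly_varying_measurable : measurable_fun (`]0, +oo[ : set R) ell ;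
  slowly_varyingP : forall lambda : R, 0 < lambda ->
    asymp_equiv (pinfty_nbhs R) (fun t => ell (lambda * t)) ell }.

(* Meant for 0 < x, where the integral converges. *)
Definition Gamma {R : realType} (x : R) : R :=
  \int[lebesgue_measure]_(t in `]0, +oo[) (t `^ (x - 1) * expR (- t)).

Section dynamics.
Context {d : measure_display} {X : measurableType d} {R : realType}.
Variables (mu : {measure set X -> \bar R}) (T : X -> X).

Definition wandering (W : set X) : Prop :=
  measurable W /\ trivIset setT (fun n => iter n T @^-1` W).

Record CEMPT : Prop := MkCEMPT {
  CEMPT_measurable : measurable_fun setT T ;
  CEMPT_preserving : forall A, measurable A -> mu (T @^-1` A) = mu A ;
  CEMPT_conservative : forall W, wandering W -> mu W = 0%E ;
  CEMPT_ergodic : forall A, measurable A -> T @^-1` A = A ->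
    mu A = 0%E \/ mu (~` A) = 0%E }.

(* [hT] acts on representatives: duality determines [hT u] up to a null set,
   so a transfer operator in this sense is an arbitrary choice of versions. *)
Definition transfer_operator (hT : (X -> R) -> X -> R) : Prop :=
  forall u, u \in Lfun mu 1 ->
    hT u \in Lfun mu 1 /\
    forall v, v \in Lfun mu +oo%E ->
      (\int[mu]_x (v (T x) * u x)%:E = \int[mu]_x (v x * hT u x)%:E)%E.

Definition mu_density (u : X -> R) (A : set X) : \bar R :=
  (\int[mu]_(x in A) (u x)%:E)%E.

Variable Y : set X.

(* The infimum of the empty set is +oo. *)
Definition return_time (x : X) : \bar R :=
  ereal_inf [set k%:R%:E | k in [set k | (0 < k)%N /\ Y (iter k T x)]].

Definition level (n : nat) : set X :=
  if n is 0 then Y else ~` Y `&` [set x | return_time x = n%:R%:E].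

(* The measure is at most n * mu Y, so [fine] loses nothing if mu Y is finite. *)
Definition wandering_rate (n : nat) : R :=
  fine (mu (\bigcup_(k < n) (iter k T @^-1` Y))).

Definition Qlaplace (s : R) : R :=
  limn (series (fun n : nat =>
    expR (- (n%:R * s)) * (wandering_rate n.+1 - wandering_rate n))).

Definition norming (alpha t : R) : R :=
  t / (Gamma (1 + alpha) * Qlaplace t^-1).

Definition occupation (n : nat) (x : X) : R :=
  \sum_(1 <= k < n.+1) \1_Y (iter k T x).

End dynamics.

Arguments return_time {d X} R T Y x.
Arguments level {d X} R T Y n.

(* Main.v *)
Require Import Defs.
From HB Require Import structures.
From mathcomp Require Import all_boot all_order all_algebra.
From mathcomp Require Import all_classical all_reals all_analysis.
From mathcomp Require Import measurable_realfun ess_sup_inf.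
From mathcomp Require Import ring lra zify.

Set Implicit Arguments.
Unset Strict Implicit.
Unset Printing Implicit Defensive.

Import Order.TTheory GRing.Theory Num.Theory.
Import numFieldNormedType.Exports.

Local Open Scope classical_set_scope.
Local Open Scope ring_scope.

(** Write S_n for the number of visits to Y during the first n steps, w_n for
the wandering rate, and F_J(n) for the measure of Y ∩ {S_n <= J}. The event
S_n / a(n) <= c(n) is S_n <= J_n, where J_n is the integer part of c(n) a(n),
so the theorem is about F_J(n) along J = J_n. The idea is to estimate the sums
V_J(N) = sum_(j < N) F_J(j) and to recover F from them by monotonicity.

Since S_(N+1) = (1_Y + S_N) o T, invariance of mu gives
mu (S_(N+1) > i) = mu (S_N > i) + mu (Y ∩ {S_N = i}), and summation yields the
exact formula V_J(N) = sum_(i <= J) mu (S_N > i) ([sum_few_visits]). Every term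
is at most mu (S_N > 0) = w_N, hence V_J(N) <= (J + 1) w_N; every term is at
least w_N - mu (0 < S_N <= J). To bound the error, split {0 < S_N <= J}
according to the first time k at which the orbit is in Y, that is, according to
the level Y_k containing the point. If k <= N - M, the orbit then makes at most
J visits in M more steps; by duality, the uniform bound on the averaged transfer
operators controls all these pieces together by C w_(N+1) F_J(M), and F_J(M) <= V_J(M) / M <= (J + 1) w_M / M. The
remaining levels have total measure w_(N+1) - w_(N-M+1), because
mu (Y_k) = w_(k+1) - w_k ([sum_few_visits_ge_transfer]).

Put q_n = (J_n + 1) w_n / n. If q_n tends to 0, the choice M ~ n sqrt(q_n)
makes both errors o(w_n), so V_(J_n)(x n) ~ x^(1-alpha) (J_n + 1) w_n for every
x > 0. As F_J is nonincreasing, F_(J_n)(n) lies between the slopes of the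
secants of V_(J_n) on either side of n, whence F_(J_n)(n) ~ (1 - alpha) q_n
([monotone_density]).

It remains to evaluate q_n. An Abelian theorem gives
Q(1/t) ~ Gamma(2-alpha) t^(1-alpha) ell(t) ([laplace_cvg]), which is the stated
asymptotics of the norming function and shows that
q_n ~ c(n) / (Gamma(1+alpha) Gamma(2-alpha)); in particular q_n tends to 0. The
constant is then the reflection formula
Gamma(1+x) Gamma(2-x) sin(pi x) / (pi x) = 1 - x ([Gamma_reflection]).

The analytic ingredients are the uniform convergence theorem for slowly varying
functions in sequential form ([slowly_varying_cvg]), and the reflection formula,
obtained from Euler's product for the sine ([sine_product]) and the
log-convexity bound Gamma(y+x) <= Gamma(y) y^x ([Gamma_addr_le]). *)

(** * The Gamma function on [1, +oo[ *)

Section gamma.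
Context {R : realType}.
Notation leb := (@lebesgue_measure R).
Implicit Types (p t x y : R) (n : nat).

(** Half of the exponential decay absorbs any power; the other half remains as an
explicitly integrable majorant. *)
Lemma powR_expR_bound p : 0 <= p ->
  exists2 K, 0 <= K & forall t, 0 <= t -> t `^ p * expR (- t) <= K * expR (- (2^-1 * t)).
Proof.
move=> p0; set n := `|Num.ceil p|%N.
have pn : p <= n%:R.
  rewrite /n natr_absz ger0_norm ?ceil_ge//.
  by rewrite -(ler_int R) (le_trans p0)// ceil_ge.
exists (1 + 2 ^+ n.+1 * n.+1`!%:R); first by rewrite addr_ge0// mulr_ge0.
move=> t t0.
have -> : expR (- t) = expR (- (2^-1 * t)) * expR (- (2^-1 * t)).
  by rewrite -expRD; congr expR; field.
rewrite mulrA ler_pM2r ?expR_gt0// expRN ler_pdivrMr ?expR_gt0//.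
have e1 : 1 <= expR (2^-1 * t) by rewrite -expR0 ler_expR mulr_ge0.
have [t1|t1] := leP t 1.
  rewrite (@le_trans _ _ 1)//.
    by rewrite -[leRHS](congr1 (fun f => f p) (powR1 R)) ge0_ler_powR// nnegrE.
  by rewrite -[leLHS]mulr1 ler_pM// lerDl mulr_ge0.
have : t `^ p <= t ^+ n.+1.
  rewrite -powR_mulrn; last by lra.
  apply: ler_powR; first exact: ltW.
  by rewrite (le_trans pn)// ler_nat.
move/le_trans; apply.
have h : (2^-1 * t) ^+ n.+1 / n.+1`!%:R <= expR (2^-1 * t).
  have := @expR_ge1Dxn R (2^-1 * t) n.
  by move=> /(_ ltac:(lra)); lra.
rewrite ler_pdivrMr ?ltr0n ?fact_gt0// exprMn in h.
have : t ^+ n.+1 <= 2 ^+ n.+1 * (expR (2^-1 * t) * n.+1`!%:R).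
  rewrite -ler_pdivrMl ?exprn_gt0//.
  by rewrite -exprVn.
move/le_trans; apply.
rewrite mulrDl mul1r -mulrA [_`!%:R * _]mulrC lerDr; exact: expR_ge0.
Qed.

Lemma cvg_expR_half : expR (- (2^-1 * t)) @[t --> +oo] --> (0 : R).
Proof.
apply: (@cvg_comp _ _ _ (fun t : R => 2^-1 * t) (fun u => expR (- u)) _ (pinfty_nbhs R)).
  exact: gt0_cvgMry.
exact: cvgr_expR.
Qed.

Lemma cvg_powR_expR p : 0 <= p -> t `^ p * expR (- t) @[t --> +oo] --> (0 : R).
Proof.
move=> /powR_expR_bound[K K0 hK].
apply: (@squeeze_cvgr _ _ _ _ (fun=> 0) (fun t => K * expR (- (2^-1 * t)))).
- near=> t; rewrite mulr_ge0 ?powR_ge0 ?expR_ge0//= hK//.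
- exact: cvg_cst.
- by rewrite -[X in _ --> X](mulr0 K); apply: cvgMr; exact: cvg_expR_half.
Unshelve. all: by end_near. Qed.

Lemma within_continuous_powR p : 0 <= p -> {within `[0, +oo[, continuous (fun t : R => t `^ p)}.
Proof.
rewrite le_eqVlt => /predU1P[<-|p0].
  rewrite (_ : (fun t => _) = cst 1); last by apply/funext => t; rewrite powRr0.
  by apply: continuous_subspaceT => x; exact: cvg_cst.
apply/continuous_within_itvcyP; split.
  move=> x; rewrite in_itv/= andbT => x0.
  apply/differentiable_continuous/derivable1_diffP.
  by apply: derivable_powR; rewrite in_itv/= x0.
by rewrite powR0 ?gt_eqF//; exact: powR_cvg0.
Qed.

Lemma continuous_expRN : continuous (fun t : R => expR (- t)).
Proof.
move=> t; apply: (@continuous_comp _ _ _ (fun t : R => - t) expR).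
  exact: opp_continuous.
exact: continuous_expR.
Qed.

Lemma within_continuous_gammaf p : 0 <= p ->
  {within `[0, +oo[, continuous (fun t : R => t `^ p * expR (- t))}.
Proof.
move=> p0 x; apply: cvgM; first exact: within_continuous_powR.
apply: continuous_subspaceT => {}x.
exact: continuous_expRN.
Qed.

Lemma measurable_gammaf p : measurable_fun [set: R] (fun t : R => t `^ p * expR (- t)).
Proof.
apply: measurable_funM; first exact: measurable_powR.
by apply: measurableT_comp => //; exact: measurable_expR.
Qed.

Lemma measurable_gammafE p (D : set R) :
  measurable_fun D (fun t : measurableTypeR R => (t `^ p * expR (- t))%:E).
Proof. by apply/measurable_EFinP; apply: measurable_funTS; exact: measurable_gammaf. Qed.

Lemma continuous_expR_half K : continuous (fun t : R => K * expR (- (2^-1 * t))).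
Proof.
move=> x; apply: cvgMr.
apply: (@continuous_comp _ _ _ (fun t : R => - (2^-1 * t)) expR); last exact: continuous_expR.
by apply: cvgN; apply: cvgMr; exact: cvg_id.
Qed.

Lemma measurable_expR_halfE K (D : set R) :
  measurable_fun D (fun t : measurableTypeR R => (K * expR (- (2^-1 * t)))%:E).
Proof.
apply/measurable_EFinP; apply: measurable_funTS; apply: continuous_measurable_fun.
exact: continuous_expR_half.
Qed.

Lemma integral_expR_half K : 0 <= K ->
  (\int[leb]_(t in `[0%R, +oo[) (K * expR (- (2^-1 * t)))%:E = (2 * K)%:E)%E.
Proof.
move=> K0.
rewrite (@ge0_continuous_FTC2y _ _ (fun t => - (2 * K * expR (- (2^-1 * t)))) _ 0)//.
- by rewrite mulr0 oppr0 expR0 mulr1 EFinN oppeK add0e.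
- by move=> x _; rewrite mulr_ge0 ?expR_ge0.
- by apply: continuous_subspaceT; exact: continuous_expR_half.
- rewrite -oppr0 -[X in - X](mulr0 (2 * K)); apply: cvgN; apply: cvgMr.
  exact: cvg_expR_half.
- by apply: cvg_at_right_filter; apply: cvgN; exact: continuous_expR_half.
- move=> x _; rewrite derive1E; apply: derive_val.
  apply: is_derive_eq.
  by rewrite /GRing.scale/=; field.
Qed.

(** On [1, +oo[ the integrand is continuous up to 0, so the integral over the
closed half-line is accessible to the fundamental theorem of calculus. *)
Lemma GammaE x : 1 <= x ->
  (Gamma x)%:E = (\int[leb]_(t in `[0%R, +oo[) (t `^ (x - 1) * expR (- t))%:E)%E.
Proof.
move=> x1; rewrite -subr_ge0 in x1.
rewrite -integral_itv_obnd_cbnd; last first.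
  by exact: measurable_gammafE.
rewrite /Gamma /Rintegral fineK// ge0_fin_numE; last first.
  by apply: integral_ge0 => t _; rewrite lee_fin mulr_ge0 ?powR_ge0 ?expR_ge0.
rewrite integral_itv_obnd_cbnd; last first.
  by exact: measurable_gammafE.
have [K K0 hK] := powR_expR_bound x1.
apply: (@le_lt_trans _ _ (2 * K)%:E); last exact: ltry.
rewrite -integral_expR_half//; apply: ge0_le_integral => //.
- by move=> t _; rewrite lee_fin mulr_ge0 ?powR_ge0 ?expR_ge0.
- by exact: measurable_gammafE.
- exact: measurable_expR_halfE.
- by move=> t; rewrite /= in_itv/= andbT => t0; rewrite lee_fin hK.
Qed.

Lemma Gamma1 : Gamma (1 : R) = 1.
Proof.
apply/EFin_inj; rewrite GammaE//.
rewrite subrr (@ge0_continuous_FTC2y _ _ (fun t => - expR (- t)) _ 0)//.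
- by rewrite oppr0 expR0 EFinN oppeK add0e.
- by move=> t _; rewrite mulr_ge0 ?powR_ge0 ?expR_ge0.
- exact: within_continuous_gammaf.
- by rewrite -oppr0; apply: cvgN; exact: cvgr_expR.
- apply: cvg_at_right_filter; apply: cvgN.
  exact: continuous_expRN.
- by move=> x _; rewrite derive1E derive_val powRr0 mul1r; ring.
Qed.

Lemma GammaD1 x : 1 <= x -> Gamma (x + 1) = x * Gamma x.
Proof.
move=> x1; have x10 : 0 <= x - 1 by rewrite subr_ge0.
have x0 : 0 < x by lra.
have [K K0 hK] := powR_expR_bound x10.
have mg p := @measurable_gammaf p.
(* The primitive of t^x e^(-t) - x t^(x-1) e^(-t) is - t^x e^(-t). A multiple of
   e^(-t/2) is added to make the integrand nonnegative, as the fundamental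
   theorem on an unbounded interval requires. *)
have dF t : 0 < t -> is_derive t 1
    (fun t => - (t `^ x * expR (- t)) - 2 * (x * K) * expR (- (2^-1 * t)))
    (t `^ x * expR (- t) - x * (t `^ (x - 1) * expR (- t)) + x * K * expR (- (2^-1 * t))).
  move=> t0; have dp := is_derive1_powR x t0.
  apply: is_derive_eq.
  by rewrite /GRing.scale/=; field.
have key0 t : 0 <= t ->
  0 <= t `^ x * expR (- t) - x * (t `^ (x - 1) * expR (- t)) + x * K * expR (- (2^-1 * t)).
  move=> /hK h; have := mulr_ge0 (powR_ge0 t x) (expR_ge0 (- t)).
  have := ler_wpM2l (ltW x0) h; lra.
have key : (\int[leb]_(t in `[0%R, +oo[) (t `^ x * expR (- t) - x * (t `^ (x - 1) * expR (- t))
    + x * K * expR (- (2^-1 * t)))%:E = (2 * (x * K))%:E)%E.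
  rewrite (@ge0_continuous_FTC2y _ _ (fun t => - (t `^ x * expR (- t)) - 2 * (x * K) * expR (- (2^-1 * t))) _ 0)//.
  - rewrite powR0 ?gt_eqF// mul0r oppr0 sub0r mulr0 oppr0 expR0 mulr1 EFinN oppeK.
    by rewrite add0e.
  - move=> t; apply: cvgD; first apply: cvgB.
    + by apply: within_continuous_gammaf; exact: ltW.
    + by apply: cvgMr; exact: within_continuous_gammaf.
    + by move: t; apply: continuous_subspaceT; exact: continuous_expR_half.
  - have h1 := cvgN (cvg_powR_expR (ltW x0)).
    have h2 := cvgMr (a := 2 * (x * K)) cvg_expR_half.
    by have := cvgB (h1 _) (h2 _); rewrite mulr0 oppr0 addr0; apply.
  - by move=> t /dF[].
  - apply: cvgB; last first.
      by apply: cvg_at_right_filter; exact: continuous_expR_half.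
    apply: cvgN; apply: cvgM; first by rewrite powR0 ?gt_eqF//; exact: powR_cvg0.
    apply: cvg_at_right_filter.
    exact: continuous_expRN.
  - by move=> t; rewrite in_itv/= andbT => /dF dFt; rewrite derive1E derive_val.
have GE y : 1 <= y -> (\int[leb]_(t in `[0%R, +oo[) (t `^ (y - 1) * expR (- t))%:E = (Gamma y)%:E)%E.
  by move=> y1; rewrite GammaE.
have : ((Gamma (x + 1))%:E + (2 * (x * K))%:E = (2 * (x * K))%:E + (x * Gamma x)%:E)%E.
  rewrite -[in LHS]integral_expR_half; last by rewrite mulr_ge0// ltW.
  rewrite -key EFinM -(GE (x + 1)); last by lra.
  rewrite -GE// addrK.
  rewrite -ge0_integralZl_EFin//; last 3 first.
  - by move=> t _; rewrite lee_fin mulr_ge0 ?powR_ge0 ?expR_ge0.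
  - exact: measurable_gammafE.
  - exact: ltW.
  rewrite -!ge0_integralD//.
  - by apply: eq_integral => t _; rewrite -EFinM -!EFinD; congr EFin; ring.
  - by move=> t; rewrite /= in_itv/= andbT lee_fin => /key0.
  - apply/measurable_EFinP; apply: measurable_funD.
      apply: measurable_funB; first by apply: measurable_funTS; exact: measurable_gammaf.
      by apply: measurable_funM => //; apply: measurable_funTS; exact: measurable_gammaf.
    apply: measurable_funTS; apply: continuous_measurable_fun; exact: continuous_expR_half.
  - by move=> t t0; rewrite -EFinM lee_fin mulr_ge0// ?(ltW x0)// mulr_ge0 ?powR_ge0 ?expR_ge0.
  - apply: measurable_funeM; exact: measurable_gammafE.
  - by move=> t _; rewrite lee_fin mulr_ge0 ?powR_ge0 ?expR_ge0.
  - exact: measurable_gammafE.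
  - by move=> t t0; rewrite lee_fin mulr_ge0 ?expR_ge0// mulr_ge0// ltW.
  - exact: measurable_expR_halfE.
by rewrite -!EFinD => -[] h; lra.
Qed.

Lemma Gamma_fact n : Gamma (n.+1%:R : R) = n`!%:R.
Proof.
elim: n => [|n IH]; first exact: Gamma1.
by rewrite -natr1 GammaD1 ?IH ?ler1n// factS natrM.
Qed.

Lemma Gamma_shift x n : 1 <= x -> Gamma (x + n%:R) = Gamma x * \prod_(k < n) (x + k%:R).
Proof.
move=> x1; elim: n => [|n IH]; first by rewrite addr0 big_ord0 mulr1.
rewrite -natr1 addrA GammaD1; last by rewrite (le_trans x1)// lerDl.
by rewrite IH big_ord_recr/= mulrC mulrA.
Qed.

(** Weighted arithmetic-geometric inequality, from ln v <= ln w + (v / w - 1)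
applied at v = 1 and v = z with w the right-hand side. *)
Lemma powR_le_affine x z : 0 <= x <= 1 -> 0 < z -> z `^ x <= 1 - x + x * z.
Proof.
move=> /andP[x0 x1] z0; set w := 1 - x + x * z.
have w0 : 0 < w.
  rewrite /w; move: x1; rewrite le_eqVlt => /predU1P[->|x1]; first by lra.
  by have := mulr_ge0 x0 (ltW z0); lra.
have lnle v : 0 < v -> ln v <= ln w + (v / w - 1).
  move=> v0; rewrite -lerBlDl -ln_div ?posrE//.
  have := @le_ln1Dx R (v / w - 1); rewrite addrCA subrr addr0; apply.
  by have := divr_gt0 v0 w0; lra.
rewrite -ler_ln ?posrE ?powR_gt0// ln_powR.
have /(ler_wpM2l x0) hz := lnle _ z0.
have x10 : 0 <= 1 - x by lra.
have /(ler_wpM2l x10) := lnle _ ltr01; rewrite ln1 => h1.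
suff : x * (z / w - 1) + (1 - x) * (1 / w - 1) = 0 by lra.
have w1 : w != 0 by rewrite gt_eqF.
transitivity ((1 - x + x * z) / w - 1); first by ring.
by rewrite -/w divff// subrr.
Qed.

Lemma Gamma_ge0 x : 0 <= Gamma x.
Proof.
by rewrite /Gamma; apply: Rintegral_ge0 => t _; rewrite mulr_ge0 ?powR_ge0 ?expR_ge0.
Qed.

(** By [powR_le_affine] applied to t / y,
t^(y+x-1) <= y^x ((1 - x) t^(y-1) + (x / y) t^y); integrating against e^(-t)
and using Gamma (y + 1) = y Gamma y gives the bound. *)
Lemma Gamma_addr_le x y : 1 <= y -> 0 <= x <= 1 -> Gamma (y + x) <= Gamma y * y `^ x.
Proof.
move=> y1 x01; have /andP[x0 x1] := x01; have y0 : 0 < y by lra.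
have [x_0|xn0] := eqVneq x 0; first by rewrite x_0 addr0 powRr0 mulr1.
have x_gt0 : 0 < x by rewrite lt_def xn0.
have c0 : 0 <= (1 - x) * y `^ x by rewrite mulr_ge0 ?powR_ge0//; lra.
have d0 : 0 <= x / y * y `^ x by rewrite mulr_ge0 ?powR_ge0// divr_ge0// ltW.
suff : ((Gamma (y + x))%:E <= ((1 - x) * y `^ x)%:E * (Gamma y)%:E + (x / y * y `^ x)%:E * (Gamma (y + 1))%:E)%E.
  rewrite -!EFinM -EFinD lee_fin => /le_trans; apply.
  rewrite GammaD1// le_eqVlt; apply/orP; left; apply/eqP.
  by field; rewrite gt_eqF.
rewrite (GammaE y1) (@GammaE (y + x)); last by lra.
rewrite (@GammaE (y + 1)); last by lra.
rewrite -!ge0_integralZl_EFin//; do ?exact: measurable_gammafE; last 2 first.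
- by move=> t _; rewrite lee_fin mulr_ge0 ?powR_ge0 ?expR_ge0.
- by move=> t _; rewrite lee_fin mulr_ge0 ?powR_ge0 ?expR_ge0.
rewrite -ge0_integralD//; last 4 first.
- by move=> t _; rewrite -EFinM lee_fin !mulr_ge0 ?powR_ge0 ?expR_ge0//; lra.
- apply: measurable_funeM; exact: measurable_gammafE.
- by move=> t _; rewrite -EFinM lee_fin !mulr_ge0 ?powR_ge0 ?expR_ge0 ?invr_ge0//; lra.
- apply: measurable_funeM; exact: measurable_gammafE.
apply: ge0_le_integral => //.
- by move=> t _; rewrite lee_fin mulr_ge0 ?powR_ge0 ?expR_ge0.
- exact: measurable_gammafE.
- by apply: emeasurable_funD; apply: measurable_funeM; exact: measurable_gammafE.
move=> t; rewrite /= in_itv/= andbT => t0.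
rewrite -!EFinM -EFinD lee_fin addrK.
rewrite [leRHS](_ : _ = expR (- t) * (y `^ x * ((1 - x) * t `^ (y - 1) + x / y * t `^ y))); last by ring.
rewrite mulrC ler_wpM2l ?expR_ge0//.
move: t0; rewrite le_eqVlt => /predU1P[<-|t0].
  rewrite (@powR0 _ (y + x - 1)); last by rewrite gt_eqF//; lra.
  rewrite mulr_ge0 ?powR_ge0// addr_ge0// mulr_ge0 ?powR_ge0//; first by lra.
  by rewrite divr_ge0// ltW.
rewrite -addrAC (@powRD _ t (y - 1) x); last by apply/implyP => _; rewrite gt_eqF.
have -> : t `^ y = t * t `^ (y - 1) by rewrite mulr_powRB1// ltW.
rewrite [leRHS](_ : _ = t `^ (y - 1) * (y `^ x * (1 - x + x * (t / y)))); last by ring.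
rewrite ler_wpM2l ?powR_ge0//.
have -> : t `^ x = y `^ x * (t / y) `^ x.
  by rewrite -powRM ?divr_ge0 ?(ltW t0) ?(ltW y0)// mulrCA divff ?mulr1// gt_eqF.
by rewrite ler_wpM2l ?powR_ge0// powR_le_affine// divr_gt0.
Qed.
End gamma.

(** * Euler's sine product and the reflection formula *)

(** The derivation rules are restated for explicit lambda-abstractions, so that
derivatives of concrete trigonometric expressions can be assembled by
application, with no unification up to pointwise operations. *)
Lemma is_deriveM_fun (R : realType) (t : R) (f g : R -> R) (df dg : R) :
  is_derive t 1 f df -> is_derive t 1 g dg ->
  is_derive t 1 (fun u => f u * g u) (f t * dg + g t * df).
Proof. by move=> df1 dg1; exact (is_deriveM df1 dg1). Qed.

Lemma is_deriveB_fun (R : realType) (t : R) (f g : R -> R) (df dg : R) :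
  is_derive t 1 f df -> is_derive t 1 g dg ->
  is_derive t 1 (fun u => f u - g u) (df - dg).
Proof. by move=> df1 dg1; exact (is_deriveB df1 dg1). Qed.

Lemma is_deriveZ_fun (R : realType) (t k : R) (f : R -> R) (df : R) :
  is_derive t 1 f df ->
  is_derive t 1 (fun u => k * f u) (k * df).
Proof. by move=> df1; exact (is_deriveZ k df1). Qed.

Lemma is_derive_sinM (R : realType) (a t : R) :
  is_derive t 1 (fun u => sin (a * u)) (cos (a * t) * a).
Proof.
have h := is_deriveZ_fun a (is_derive_id t 1); rewrite mulr1 in h.
exact (@is_derive1_comp _ sin (fun t => a * t) _ _ _ (is_derive_sin (a * t)) h).
Qed.

Lemma is_derive_cosM (R : realType) (a t : R) :
  is_derive t 1 (fun u => cos (a * u)) (- sin (a * t) * a).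
Proof.
have h := is_deriveZ_fun a (is_derive_id t 1); rewrite mulr1 in h.
exact (@is_derive1_comp _ cos (fun t => a * t) _ _ _ (is_derive_cos (a * t)) h).
Qed.

Lemma is_derive_cosX (R : realType) (m : nat) (t : R) :
  is_derive t 1 (fun u => cos u ^+ m.+1) (m.+1%:R * cos t ^+ m * - sin t).
Proof.
rewrite (_ : (fun _ => _) = cos ^+ m.+1); last by apply/funext => u; rewrite exprfctE.
exact (@is_deriveX _ _ cos m.+1 t 1 _ (is_derive_cos t)).
Qed.

Section sine_product.
Context {R : realType}.
Notation leb := (@lebesgue_measure R).
Implicit Types (a t x : R) (n : nat).

(** Euler's product comes from the dependence of this integral on n:
[cosint_rec] moves from n to n + 2 at the price of a factor, whose quotient by
the same factor for a = 0 is a factor of the product. *)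
Definition cosint a n : R := \int[leb]_(t in `[0, pi / 2]) (cos (a * t) * cos t ^+ n).

Lemma continuous_cosf a n : continuous (fun t : R => cos (a * t) * cos t ^+ n).
Proof.
move=> t; apply: cvgM.
  apply: (@continuous_comp _ _ _ (fun t => a * t) cos); last exact: continuous_cos.
  by apply: cvgMr; exact: cvg_id.
apply: (@continuous_comp _ _ _ cos (fun y => y ^+ n)); first exact: continuous_cos.
exact: exprn_continuous.
Qed.

Lemma integrable_pihalf (f : R -> R) : continuous f -> leb.-integrable `[0, pi / 2] (EFin \o f).
Proof.
move=> cf; apply: continuous_compact_integrable; first exact: segment_compact.
exact: continuous_subspaceT.
Qed.

Lemma pihalf_gt0 : 0 < pi / 2 :> R.
Proof. by rewrite divr_gt0// pi_gt0. Qed.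

Lemma Rintegral_pihalf_FTC (f F : R -> R) : continuous f -> (forall t, is_derive t 1 F (f t)) ->
  \int[leb]_(t in `[0, pi / 2]) f t = F (pi / 2) - F 0.
Proof.
move=> cf dF.
have cF t : F x @[x --> t] --> F t.
  by apply/differentiable_continuous/derivable1_diffP; have [] := dF t.
rewrite /Rintegral (@continuous_FTC2 _ f F)//.
- exact: pihalf_gt0.
- exact: continuous_subspaceT.
- split.
  + by move=> t _; have [] := dF t.
  + by apply: cvg_at_right_filter; exact: cF.
  + by apply: cvg_at_left_filter; exact: cF.
- by move=> t _; rewrite derive1E derive_val.
Qed.

Lemma Rintegral_pihalf_lin k l (f g : R -> R) : continuous f -> continuous g ->
  \int[leb]_(t in `[0, pi / 2]) (k * f t + l * g t) =
  k * (\int[leb]_(t in `[0, pi / 2]) f t) + l * (\int[leb]_(t in `[0, pi / 2]) g t).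
Proof.
move=> cf cg.
have If : leb.-integrable `[0, pi / 2] (EFin \o f) by exact: integrable_pihalf.
have Ig : leb.-integrable `[0, pi / 2] (EFin \o g) by exact: integrable_pihalf.
have Ikf : leb.-integrable `[0, pi / 2] (EFin \o (fun t => k * f t)).
  by apply: integrable_pihalf => t; apply: cvgMr; exact: cf.
have Ilg : leb.-integrable `[0, pi / 2] (EFin \o (fun t => l * g t)).
  by apply: integrable_pihalf => t; apply: cvgMr; exact: cg.
by rewrite RintegralD//= !RintegralZl.
Qed.

Lemma le_Rintegral_pihalf (f g : R -> R) : continuous f -> continuous g ->
  (forall t, 0 <= t <= pi / 2 -> f t <= g t) ->
  \int[leb]_(t in `[0, pi / 2]) f t <= \int[leb]_(t in `[0, pi / 2]) g t.
Proof.
move=> cf cg fg.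
have If : leb.-integrable `[0, pi / 2] (EFin \o f) by exact: integrable_pihalf.
have Ig : leb.-integrable `[0, pi / 2] (EFin \o g) by exact: integrable_pihalf.
by apply: le_Rintegral => // t; rewrite /= in_itv/=; exact: fg.
Qed.

Lemma cosint_rec_algebra (K : comRingType) (a s c C S k m : K) : s * s = 1 - c * c ->
  - ((m + 1 + 1) ^+ 2 - a ^+ 2) * (C * (c * (c * k))) +
  (m + 1 + 1) * (m + 1) * (C * k) =
  a * S * ((m + 1 + 1) * (c * k) * - s) + c * (c * k) * (a * (C * a)) -
  ((m + 1 + 1) * C * (c * k * c + s * ((m + 1) * k * - s)) +
   c * k * s * ((m + 1 + 1) * (- S * a))).
Proof.
move=> s2.
transitivity (a * S * ((m + 1 + 1) * (c * k) * - s) + c * (c * k) * (a * (C * a)) -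
  ((m + 1 + 1) * C * (c * k * c + (m + 1) * k * - (s * s)) +
   c * k * s * ((m + 1 + 1) * (- S * a)))); last by ring.
by rewrite s2; ring.
Qed.

(** Integrate the derivative of
a sin(a t) cos^(n+2) t - (n+2) cos(a t) cos^(n+1) t sin t, which vanishes at
both ends of [0, pi/2]. *)
Lemma cosint_rec a n :
  (n.+2%:R ^+ 2 - a ^+ 2) * cosint a n.+2 = n.+2%:R * n.+1%:R * cosint a n.
Proof.
pose H t := a * sin (a * t) * cos t ^+ n.+2 - n.+2%:R * cos (a * t) * (cos t ^+ n.+1 * sin t).
pose f t := - (n.+2%:R ^+ 2 - a ^+ 2) * (cos (a * t) * cos t ^+ n.+2) +
  n.+2%:R * n.+1%:R * (cos (a * t) * cos t ^+ n).
have cf : continuous f by move=> t; apply: cvgD; apply: cvgMr; exact: continuous_cosf.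
have dH t : is_derive t 1 H (f t).
  have h1 := is_deriveM_fun (is_deriveZ_fun a (is_derive_sinM a t)) (is_derive_cosX n.+1 t).
  have h2 := is_deriveM_fun (is_deriveZ_fun n.+2%:R (is_derive_cosM a t)) (is_deriveM_fun (is_derive_cosX n t) (is_derive_sin t)).
  have h := is_deriveB_fun h1 h2.
  suff -> : f t = a * sin (a * t) * (n.+2%:R * cos t ^+ n.+1 * - sin t) +
    cos t ^+ n.+2 * (a * (cos (a * t) * a)) -
    (n.+2%:R * cos (a * t) * (cos t ^+ n.+1 * cos t + sin t * (n.+1%:R * cos t ^+ n * - sin t)) +
     cos t ^+ n.+1 * sin t * (n.+2%:R * (- sin (a * t) * a))) by exact h.
  have s2 : sin t * sin t = 1 - cos t * cos t by have := sin2cos2 t; rewrite !expr2.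
  rewrite /f [cos t ^+ n.+2]exprS [cos t ^+ n.+1]exprS.
  by rewrite -!natr1; exact: cosint_rec_algebra.
have := Rintegral_pihalf_FTC cf dH.
rewrite /f Rintegral_pihalf_lin; [|exact: continuous_cosf..].
rewrite -/(cosint a n.+2) -/(cosint a n).
rewrite /H mulr0 sin0 cos_pihalf !expr0n/= !mulr0 !mul0r mulr0 subrr => h.
lra.
Qed.

Lemma cosint_0E n : cosint 0 n = \int[leb]_(t in `[0, pi / 2]) cos t ^+ n.
Proof. by apply: eq_Rintegral => t _; rewrite mul0r cos0 mul1r. Qed.

Lemma cosint_0_0 : cosint 0 0 = pi / 2.
Proof.
rewrite cosint_0E (Rintegral_pihalf_FTC (f := cst 1) (F := id)) ?subr0//.
by move=> t; exact: cvg_cst.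
Qed.

Lemma cosint_a_0 a : a != 0 -> cosint a 0 = sin (a * (pi / 2)) / a.
Proof.
move=> a0; have cc : continuous (fun t => cos (a * t) * cos t ^+ 0) by exact: continuous_cosf.
have dF t : is_derive t 1 (fun t => a^-1 * sin (a * t)) (cos (a * t) * cos t ^+ 0).
  have h := is_deriveZ_fun a^-1 (is_derive_sinM a t).
  suff -> : cos (a * t) * cos t ^+ 0 = a^-1 * (cos (a * t) * a) by exact h.
  by rewrite expr0 mulr1 mulrCA mulVf ?mulr1.
by rewrite /cosint (Rintegral_pihalf_FTC cc dF) mulr0 sin0 mulr0 subr0 mulrC.
Qed.

Lemma cosint0_gt0 n : 0 < cosint 0 n.*2.
Proof.
elim: n => [|n IH]; first by rewrite double0 cosint_0_0 pihalf_gt0.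
have := cosint_rec 0 n.*2; rewrite expr0n subr0 doubleS => h.
have : 0 < n.*2.+2%:R ^+ 2 * cosint 0 n.*2.+2 by rewrite h !mulr_gt0.
by rewrite pmulr_rgt0// exprn_gt0.
Qed.

(** For 0 <= x <= 1, 1 - cos(2 x t) = 2 sin^2(x t) <= 2 sin^2 t, so the difference
of the two integrals is at most twice that of the integrals of cos^(2n) and
cos^(2n+2), which the recursion evaluates. *)
Lemma cosint_close x n : 0 <= x <= 1 ->
  `|cosint (2 * x) n.*2 / cosint 0 n.*2 - 1| <= n.+1%:R^-1.
Proof.
move=> /andP[x0 x1].
have g0 := cosint0_gt0 n.
have le1 : cosint (2 * x) n.*2 <= cosint 0 n.*2.
  apply: le_Rintegral_pihalf; [exact: continuous_cosf..|].
  move=> t /andP[t0 t1].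
  by rewrite ler_wpM2r// ?mul0r ?cos0 ?cos_le1// exprn_even_ge0// odd_double.
have cc a m := @continuous_cosf a m.
have le2 : 1 * cosint 0 n.*2 + (- 1) * cosint (2 * x) n.*2 <= 2 * cosint 0 n.*2 + (- 2) * cosint 0 n.*2.+2.
  rewrite -!Rintegral_pihalf_lin; [|exact: cc..].
  apply: le_Rintegral_pihalf; [by move=> t; apply: cvgD; apply: cvgMr; exact: cc..|].
  move=> t /andP[t0 t1].
  rewrite !mul0r !cos0 !mul1r -mulrA.
  have -> : cos t ^+ n.*2.+2 = (1 - sin t ^+ 2) * cos t ^+ n.*2.
    by rewrite -addn2 exprD mulrC -cos2sin2.
  have e0 : 0 <= cos t ^+ n.*2 by rewrite exprn_even_ge0// odd_double.
  have -> : cos (2 * (x * t)) = 1 - 2 * sin (x * t) ^+ 2.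
    rewrite mulr_natl cos_mulr2n cos2sin2; ring.
  suff : sin (x * t) ^+ 2 * cos t ^+ n.*2 <= sin t ^+ 2 * cos t ^+ n.*2 by lra.
  rewrite ler_wpM2r//.
  have xt : x * t <= t by rewrite ler_piMl.
  have xt0 : 0 <= x * t by rewrite mulr_ge0.
  have p2 := pihalf_gt0.
  have pE := pi_gt0 R.
  rewrite ler_pXn2r// ?nnegrE.
  - move: xt; rewrite le_eqVlt => /predU1P[->//|xt].
    by rewrite ltW// ltr_sin ?in_itv//=; lra.
  - by apply: sin_ge0_pi; lra.
  - by apply: sin_ge0_pi; lra.
have rec := cosint_rec 0 n.*2.
rewrite expr0n subr0 in rec.
rewrite -[X in `|_ - X|](divff (lt0r_neq0 g0)) -mulrBl ler0_norm; last first.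
  by rewrite pmulr_lle0 ?invr_gt0// subr_le0.
rewrite -mulNr opprB ler_pdivrMr//.
apply: (@le_trans _ _ (2 * cosint 0 n.*2 - 2 * cosint 0 n.*2.+2)); first lra.
have n0 : n.*2.+2%:R != 0 :> R by rewrite pnatr_eq0.
have {}rec : n.*2.+2%:R * cosint 0 n.*2.+2 = n.*2.+1%:R * cosint 0 n.*2.
  by apply: (mulfI n0); rewrite mulrA -expr2 rec mulrA.
rewrite -(@ler_pM2l _ n.*2.+2%:R)//.
have -> : n.*2.+2%:R * (n.+1%:R^-1 * cosint 0 n.*2) = 2 * cosint 0 n.*2.
  by rewrite -doubleS -muln2 natrM [_ * 2]mulrC -mulrA mulVKf// pnatr_eq0.
rewrite mulrBr [_ * (2 * cosint 0 n.*2.+2)]mulrCA rec.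
by rewrite -[n.*2.+2%:R]natr1; lra.
Qed.

Lemma cosint_prod_algebra (K : fieldType) (x u u2 v c c' c0 c0' P : K) :
  2 != 0 :> K -> 4 != 0 :> K -> u != 0 -> v != 0 -> c0 != 0 -> c0' != 0 ->
  (u2 ^+ 2 - (2 * x) ^+ 2) * c' = u2 * v * c ->
  u2 ^+ 2 * c0' = u2 * v * c0 -> u2 = 2 * u ->
  c' / c0' * (P * (1 - x ^+ 2 / u ^+ 2)) = c / c0 * P.
Proof.
move=> n2 n4 u0 v0 c00 c0'0 h1 h2 uE.
have cE : c = (u2 ^+ 2 - (2 * x) ^+ 2) * c' / (u2 * v).
  by rewrite h1 uE; field; rewrite n2 u0 v0.
have c0E : c0 = u2 ^+ 2 * c0' / (u2 * v).
  by rewrite h2 uE; field; rewrite n2 u0 v0.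
by rewrite cE c0E uE; field; rewrite n2 n4 u0 v0 c0'0.
Qed.

Lemma cosint_prod x n : 0 < x < 1 ->
  cosint (2 * x) n.*2 / cosint 0 n.*2 * \prod_(k < n) (1 - x ^+ 2 / k.+1%:R ^+ 2) =
  sin (pi * x) / (pi * x).
Proof.
move=> /andP[x0 x1]; have p0 := pi_gt0 R.
elim: n => [|n IH].
  rewrite big_ord0 mulr1 double0 cosint_0_0 cosint_a_0; last by lra.
  rewrite (_ : 2 * x * (pi / 2) = pi * x); last by field.
  by move: (sin (@pi R * x)) (@pi R) p0 => s p p0; field; rewrite (gt_eqF p0) (gt_eqF x0).
rewrite big_ord_recr/= -{}IH doubleS.
have h1 := cosint_rec (2 * x) n.*2; have h2 := cosint_rec 0 n.*2.
have g1 := cosint0_gt0 n; have g2 := cosint0_gt0 n.+1; rewrite doubleS in g2.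
rewrite expr0n subr0 in h2.
have uE : n.*2.+2%:R = 2 * n.+1%:R :> R by rewrite -doubleS -muln2 natrM mulrC.
have n2 : (2 : R) != 0 by rewrite pnatr_eq0.
have n4 : (4 : R) != 0 by rewrite pnatr_eq0.
have u0 : n.+1%:R != 0 :> R by rewrite pnatr_eq0.
have v0 : n.*2.+1%:R != 0 :> R by rewrite pnatr_eq0.
have := cosint_prod_algebra _ n2 n4 u0 v0 (lt0r_neq0 g1) (lt0r_neq0 g2) h1 h2 uE; exact.
Qed.

(** By [cosint_prod] the partial product times a quotient of integrals is constantly
sin(pi x) / (pi x), and that quotient tends to 1 by [cosint_close]. *)
Theorem sine_product x : 0 < x < 1 ->
  \prod_(k < n) (1 - x ^+ 2 / k.+1%:R ^+ 2) @[n --> \oo] --> sin (pi * x) / (pi * x).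
Proof.
move=> x01; set r := fun n => cosint (2 * x) n.*2 / cosint 0 n.*2.
have r1 : r n @[n --> \oo] --> (1 : R).
  apply/subr_cvg0; apply/norm_cvg0P.
  apply: (@squeeze_cvgr _ _ _ _ (fun=> 0) (fun n => n.+1%:R^-1)).
  - near=> n; rewrite normr_ge0/= cosint_close//.
    by move: x01 => /andP[/ltW-> /ltW->].
  - exact: cvg_cst.
  - exact: cvg_harmonic.
rewrite -[X in _ --> X]divr1.
have h : (sin (pi * x) / (pi * x)) / r n @[n --> \oo] --> (sin (pi * x) / (pi * x)) / 1.
  by apply: cvgMr; apply: cvgV.
apply: cvg_trans h; apply: near_eq_cvg.
near=> n.
rewrite -(cosint_prod n x01) -/(r n) mulrAC divff ?mul1r//.
near: n; apply: (cvgr_neq0 _ r1); exact: oner_neq0.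
Unshelve. all: by end_near. Qed.

(** Shifting both arguments by n multiplies Gamma(1+x) Gamma(2-x) by n!^2, the
partial sine product and the factor (n+1-x) / (1-x). On the other hand
[Gamma_addr_le], used upwards and downwards, encloses the shifted product
between multiples of n!^2; comparing the two gives the value in the limit. *)
Theorem Gamma_reflection x : 0 < x < 1 ->
  Gamma (1 + x) * Gamma (2 - x) * (sin (pi * x) / (pi * x)) = 1 - x.
Proof.
move=> /andP[x0 x1]; set D := Gamma (1 + x) * Gamma (2 - x).
pose P n := \prod_(k < n) (1 - x ^+ 2 / k.+1%:R ^+ 2) : R.
have x_ge0 := ltW x0; have x_le1 := ltW x1.
have x01w : 0 <= x <= 1 by rewrite x_ge0.
have y_ge0 : 0 <= 1 - x by rewrite subr_ge0.
have y01w : 0 <= 1 - x <= 1 by rewrite y_ge0 lerBlDr lerDl.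
have key n : (1 - x) * (Gamma (n.+1%:R + x) * Gamma (n.+1%:R + (1 - x))) =
    D * P n * (n.+1%:R - x) * n`!%:R ^+ 2.
  rewrite (_ : n.+1%:R + x = (1 + x) + n%:R); last by rewrite -natr1; ring.
  rewrite (_ : n.+1%:R + (1 - x) = (2 - x) + n%:R); last by rewrite -natr1; ring.
  rewrite !Gamma_shift; [|lra..].
  suff h : (1 - x) * ((\prod_(k < n) (1 + x + k%:R)) * (\prod_(k < n) (2 - x + k%:R))) =
      P n * (n.+1%:R - x) * n`!%:R ^+ 2.
    by rewrite [X in _ * X = _]mulrACA [LHS]mulrCA h /D !mulrA.
  elim: n => [|n IH]; first by rewrite /P !big_ord0 !mulr1 mul1r fact0 expr1n mulr1.
  rewrite /P !big_ord_recr/= -/(P n) factS natrM exprMn.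
  have {}IH := congr1 (fun z => z * ((1 + x + n%:R) * (2 - x + n%:R))) IH.
  rewrite [X in _ * X = _]mulrACA [LHS]mulrA IH -[n.+2%:R]natr1 -[n.+1%:R]natr1.
  by field; rewrite natr1 pnatr_eq0.
have G0 n : 0 < n`!%:R :> R by rewrite ltr0n fact_gt0.
have up n : D * P n * (n.+1%:R - x) <= (1 - x) * n.+1%:R.
  rewrite -(ler_pM2r (exprn_gt0 2 (G0 n))) -key -mulrA.
  apply: ler_wpM2l; first lra.
  have h1 := @Gamma_addr_le R x n.+1%:R.
  have h2 := @Gamma_addr_le R (1 - x) n.+1%:R.
  apply: (@le_trans _ _ ((Gamma n.+1%:R * n.+1%:R `^ x) * (Gamma n.+1%:R * n.+1%:R `^ (1 - x)))).
    by apply: ler_pM; [exact: Gamma_ge0..|apply: h1; rewrite ?ler1n|apply: h2; rewrite ?ler1n].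
  rewrite mulrACA -powRD; last by rewrite pnatr_eq0 implybT.
  by rewrite addrC subrK powRr1// Gamma_fact expr2 mulrC.
have lo n : (1 - x) * n.+1%:R ^+ 2 <= D * P n * (n.+1%:R - x) * n.+2%:R.
  rewrite -(ler_pM2r (exprn_gt0 2 (G0 n))) [leRHS]mulrAC -key -!mulrA.
  apply: ler_wpM2l; first lra.
  rewrite mulrA -expr2 -exprMn -natrM -factS -Gamma_fact expr2.
  have nn : 1 <= n.+1%:R :> R by rewrite ler1n.
  have h1 : Gamma n.+2%:R <= Gamma (n.+1%:R + x) * n.+2%:R `^ (1 - x).
    rewrite (_ : n.+2%:R = (n.+1%:R + x) + (1 - x)); last by rewrite -[n.+2%:R]natr1; ring.
    apply: le_trans (Gamma_addr_le _ _) _ => //; first by rewrite (le_trans nn)// lerDl//.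
    apply: ler_wpM2l; first exact: Gamma_ge0.
    have nx : 0 <= n.+1%:R + x by rewrite addr_ge0.
    by apply: ge0_ler_powR; rewrite ?nnegrE ?lerDl// addr_ge0.
  have h2 : Gamma n.+2%:R <= Gamma (n.+1%:R + (1 - x)) * n.+2%:R `^ x.
    rewrite (_ : n.+2%:R = (n.+1%:R + (1 - x)) + x); last by rewrite -[n.+2%:R]natr1; ring.
    apply: le_trans (Gamma_addr_le _ _) _ => //; first by rewrite (le_trans nn)// lerDl//.
    apply: ler_wpM2l; first exact: Gamma_ge0.
    have nx : 0 <= n.+1%:R + (1 - x) by exact: addr_ge0.
    by apply: ge0_ler_powR; rewrite ?nnegrE ?lerDl// addr_ge0.
  apply: (le_trans (ler_pM _ _ h1 h2)); rewrite ?Gamma_ge0//.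
  rewrite mulrACA -powRD; last by rewrite pnatr_eq0 implybT.
  by rewrite subrK powRr1// mulrA.
have x01 : 0 < x < 1 by rewrite x0.
have lim1 : D * P n.+1 @[n --> \oo] --> D * (sin (pi * x) / (pi * x)).
  by apply: cvgMr; have := sine_product x01; rewrite -(cvg_shiftS P).
have lim2 : D * P n.+1 @[n --> \oo] --> 1 - x.
  have hh : (n.+1%:R^-1 : R) @[n --> \oo] --> (0 : R) by exact: cvg_harmonic.
  apply: (@squeeze_cvgr _ _ _ _ (fun n => (1 - x) * (1 - n.+1%:R^-1)) (fun n => (1 - x) * (1 + n.+1%:R^-1))).
  - near=> n; have := lo n.+1; have := up n.+1.
    rewrite -[n.+3%:R]natr1 -[n.+2%:R]natr1 -[n.+1%:R]natr1.
    have : 0 <= n%:R :> R by [].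
    move: (P n.+1) (n%:R) => p m m0; move: (D * p) => q {p} h1 h2.
    have m1 : m + 1 != 0 by rewrite gt_eqF//; lra.
    set v := (m + 1)^-1; have v0 : 0 <= v by rewrite invr_ge0; lra.
    have mv : m * v + v = 1 by rewrite -[X in _ + X]mul1r -mulrDl divff.
    apply/andP; split.
      have w0 : 0 < (m + 1 + 1 - x) * (m + 1 + 1 + 1) by apply: mulr_gt0; lra.
      rewrite -(ler_pM2r w0); apply: le_trans (le_trans h2 _); last by rewrite mulrA.
      rewrite -mulrA ler_wpM2l//.
      have : 0 <= x * ((1 - v) * (m + 1 + 1 + 1)).
        apply: mulr_ge0; first lra.
        apply: mulr_ge0; last lra.
        by have := mulr_ge0 m0 v0; lra.
      have : (1 - v) * ((m + 1 + 1) * (m + 1 + 1 + 1)) = (m + 1 + 1) ^+ 2 - 2 - 2 * v.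
        by have -> : m = v^-1 - 1; [rewrite /v invrK addrK | field; rewrite invr_eq0].
      rewrite !mulrDr; lra.
    have w0 : 0 < m + 1 + 1 - x by lra.
    rewrite -(ler_pM2r w0); apply: (le_trans h1).
    rewrite -mulrA ler_wpM2l//.
    have -> : (1 + v) * (m + 1 + 1 - x) = m + 1 + 1 + (1 - x) * (1 + v).
      by have -> : m = v^-1 - 1; [rewrite /v invrK addrK | field; rewrite invr_eq0].
    by rewrite lerDl; apply: mulr_ge0 => //; exact: addr_ge0.
  - have h : (1 - x) * (1 - n.+1%:R^-1) @[n --> \oo] --> (1 - x) * (1 - 0).
      by apply: cvgMr; apply: cvgB => //; exact: cvg_cst.
    by rewrite subr0 mulr1 in h.
  - have h : (1 - x) * (1 + n.+1%:R^-1) @[n --> \oo] --> (1 - x) * (1 + 0).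
      by apply: cvgMr; apply: cvgD => //; exact: cvg_cst.
    by rewrite addr0 mulr1 in h.
exact: (cvg_unique _ lim1 lim2).
Unshelve. all: by end_near. Qed.
End sine_product.

(** * Uniform convergence of slowly varying functions *)

Section translation.
Context {R : realType}.
Notation leb := (@lebesgue_measure R).
Local Open Scope ereal_scope.

Lemma measurable_addr (a : R) :
  measurable_fun [set: measurableTypeR R] ((fun x => x + a)%R : _ -> measurableTypeR R).
Proof.
apply: continuous_measurable_fun => x; apply: cvgD; [exact: cvg_id|exact: cvg_cst].
Qed.

Lemma lebesgue_measure_addr (a : R) (A : set R) : measurable A ->
  pushforward leb ((fun x => x + a)%R : measurableTypeR R -> measurableTypeR R) A = leb A.
Proof.
move=> mA; have ma := measurable_addr a.
apply/esym; apply: (@lebesgue_measure_unique R (pushforward leb ((fun x => x + a)%R : measurableTypeR R -> measurableTypeR R))) => //= _ [[b c]] _ <-.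
rewrite /pushforward.
have -> : (fun x : R => (x + a)%R) @^-1` `]b, c]%classic = `](b - a)%R, (c - a)%R]%classic.
  by apply/seteqP; split => x /=; rewrite !in_itv/= ltrBlDr lerBrDr.
rewrite !lebesgue_measure_itv/= !lte_fin ltrD2r.
by case: ifP => // _; rewrite -!EFinD; congr EFin; lra.
Qed.

Lemma ge0_integral_addr (a : R) (D : set R) (f : R -> \bar R) :
  measurable D -> measurable_fun D f -> (forall x, D x -> 0 <= f x) ->
  \int[leb]_(x in (fun x => x + a)%R @^-1` D) f (x + a)%R = \int[leb]_(x in D) f x.
Proof.
move=> mD mf f0.
rewrite -(@ge0_integral_pushforward _ _ (measurableTypeR R) (measurableTypeR R) R _ (measurable_addr a) leb D f) //; last first.
  by move=> y /[!inE]; exact: f0.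
apply: eq_measure_integral => /= [|A mA AS]; first exact: measurable_addr.
by move=> _; exact: (lebesgue_measure_addr a AS).
Qed.
End translation.

(** Truncation at 1 keeps the triangle inequality; it provides the domination in
[osc_integral_cvg0]. *)
Lemma min1_leD (R : realDomainType) (a b c : R) : `|c| <= `|a| + `|b| ->
  Num.min 1 `|c| <= Num.min 1 `|a| + Num.min 1 `|b|.
Proof.
have := normr_ge0 a; have := normr_ge0 b; move: (`|a|) (`|b|) (`|c|) => {}a {}b {}c a0 b0 cab.
by case: (leP 1 a); case: (leP 1 b); case: (leP 1 c); lra.
Qed.

Section slow_variation.
Context {R : realType}.
Notation leb := (@lebesgue_measure R).
Variable ell : R -> R.
Hypothesis svell : slowly_varying ell.

(* In logarithmic coordinates slow variation reads h (z + t) - h z -> 0 for each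
   fixed t. *)
Let h (x : R) := ln (ell (expR x)).
Let osc (z t : R) : R := Num.min 1 `|h (z + t) - h z|.

Let ell0 t : 0 < t -> 0 < ell t. Proof. exact: (slowly_varying_gt0 svell). Qed.

Lemma measurable_ln_expR : measurable_fun [set: R] h.
Proof.
apply: (measurableT_comp (@measurable_ln R)).
apply: (@measurable_comp _ _ _ R R R `]0%R, +oo[%classic ell setT expR) => //.
- by move=> _ [x _ <-]; rewrite /= in_itv/= andbT expR_gt0.
- exact: (slowly_varying_measurable svell).
Qed.

Lemma measurable_osc z (D : set R) : measurable_fun D (osc z).
Proof.
apply: measurable_funTS; apply: measurable_minr; first exact: measurable_cst.
apply: measurableT_comp => //; apply: measurable_funB; last exact: measurable_cst.
apply: measurableT_comp; first exact: measurable_ln_expR.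
apply: continuous_measurable_fun => x; apply: cvgD; [exact: cvg_cst|exact: cvg_id].
Qed.

Lemma osc_ge0 z t : 0 <= osc z t.
Proof. by rewrite /osc le_min ler01/=. Qed.

Lemma osc_cvg0 (z : nat -> R) t : z n @[n --> \oo] --> +oo -> osc (z n) t @[n --> \oo] --> (0 : R).
Proof.
move=> zoo.
have ezoo : expR (z n) @[n --> \oo] --> +oo.
  apply/cvgryPge => A; near=> n; apply: le_trans (expR_ge1Dx _).
  have : A <= z n by near: n; apply: cvgry_ge.
  by move/le_trans; apply; rewrite lerDr.
have e1 : ell (expR t * expR (z n)) / ell (expR (z n)) @[n --> \oo] --> (1 : R).
  exact: (cvg_comp _ _ ezoo (slowly_varyingP svell (expR_gt0 t))).
have e2 : h (z n + t) - h (z n) @[n --> \oo] --> (0 : R).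
  rewrite -ln1; have := cvg_comp _ _ e1 (continuous_ln (@ltr01 R)).
  apply: cvg_trans; apply: near_eq_cvg; apply: nearW => n /=.
  by rewrite ln_div ?posrE ?ell0 ?mulr_gt0 ?expR_gt0// /h [z n + t]addrC expRD.
apply: (@squeeze_cvgr _ _ _ _ (fun=> 0) (fun n => `|h (z n + t) - h (z n)|)).
- by apply: nearW => n; rewrite osc_ge0/= /osc ge_min lexx orbT.
- exact: cvg_cst.
- by rewrite -[X in _ --> X](@normr0 R R); apply: cvg_norm.
Unshelve. all: by end_near. Qed.

Let osc_integral z : \bar R := (\int[leb]_(t in `[(- 1)%R, 2%R]) (osc z t)%:E)%E.

Lemma osc_integral_cvg0 (z : nat -> R) : z n @[n --> \oo] --> +oo ->
  osc_integral (z n) @[n --> \oo] --> 0%E.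
Proof.
move=> zoo.
have mD : measurable (`[(- 1), 2]%classic : set (measurableTypeR R)) by exact: measurable_itv.
have mo n : measurable_fun (`[(- 1), 2]%classic : set (measurableTypeR R)) (fun t => (osc (z n) t)%:E).
  by apply/measurable_EFinP; exact: measurable_osc.
have m0 : measurable_fun (`[(- 1), 2]%classic : set (measurableTypeR R)) (cst 0 : _ -> \bar R)%E.
  exact: measurable_cst.
have o0 : {ae leb, forall t, `[(- 1), 2]%classic t -> (osc (z n) t)%:E @[n --> \oo] --> 0%E}.
  apply: aeW => t _; apply/cvg_EFin; first exact: nearW.
  exact: osc_cvg0.
have i1 : leb.-integrable `[(- 1), 2] (cst 1 : _ -> \bar R)%E.
  apply/integrableP; split; first exact: measurable_cst.
  rewrite (eq_integral (cst 1%E)); last by move=> t _; rewrite /= normr1.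
  rewrite integral_cst//= mul1e; apply: le_lt_trans (ltry 3); rewrite lebesgue_measure_itv/= lte_fin.
  by case: ifP => // _; rewrite -EFinD lee_fin; lra.
have o1 : {ae leb, forall t n, `[(- 1), 2]%classic t -> (`|(osc (z n) t)%:E| <= cst 1 t)%E}.
  by apply: aeW => t n _; rewrite /= lee_fin ger0_norm ?osc_ge0// /osc ge_min lexx.
by have [_ _] := dominated_convergence mD mo m0 o0 i1 o1; rewrite integral0.
Qed.

(** Averaging over t in [0, 1] removes the dependence on the point u: the
increment from x to x + u is compared with the increments from x + u and from x
to the common point x + u + t. *)
Lemma osc_le x u : `|u| <= 1 -> ((osc x u)%:E <= osc_integral (x + u) + osc_integral x)%E.
Proof.
rewrite ler_norml => /andP[u1 u2].
have sub01 : `[(0 : R), 1] `<=` `[(- 1 : R), 2].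
  move=> t; rewrite /= !in_itv/= => /andP[t0 t1].
  by rewrite (le_trans _ t0) ?lerN10// (le_trans t1) ?ler1n.
have subu : `[u, 1 + u] `<=` `[(- 1), 2].
  move=> t; rewrite /= !in_itv/= => /andP[t0 t1].
  by rewrite (le_trans _ t0)//= (le_trans t1)// -[leRHS]/(1 + 1) lerD2l.
have mD : measurable (`[0, 1]%classic : set (measurableTypeR R)) by exact: measurable_itv.
have mE : measurable (`[u, (1 + u)]%classic : set (measurableTypeR R)) by exact: measurable_itv.
have mF : measurable (`[(- 1), 2]%classic : set (measurableTypeR R)) by exact: measurable_itv.
have mo z (D : set (measurableTypeR R)) : measurable_fun D (fun t => (osc z t)%:E).
  by apply/measurable_EFinP; exact: measurable_osc.
have o0 z t : (0 <= (osc z t)%:E)%E by rewrite lee_fin osc_ge0.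
have -> : ((osc x u)%:E = \int[leb]_(t in `[0%R, 1%R]) (osc x u)%:E)%E.
  rewrite integral_cst//= (_ : lebesgue_measure _ = 1%E) ?mule1//.
  by rewrite lebesgue_measure_itv/= lte_fin ltr01 -EFinB subr0.
have h1 : (\int[leb]_(t in `[0%R, 1%R]) (osc (x + u) t)%:E <= osc_integral (x + u))%E.
  apply: (@ge0_subset_integral _ (measurableTypeR R) R leb _ _ mD mF (fun t => (osc (x + u) t)%:E) (mo _ _)) => //.
have h2 : (\int[leb]_(t in `[0%R, 1%R]) (osc x (t + u))%:E <= osc_integral x)%E.
  have E : (fun t : R => t + u) @^-1` `[u, 1 + u]%classic = `[0, 1]%classic.
    by apply/seteqP; split => t /=; rewrite !in_itv/= lerDr lerD2r.
  have hE := @ge0_integral_addr R u `[u, (1 + u)]%classic (fun t => (osc x t)%:E) mE (mo _ _) (fun t _ => o0 _ _).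
  rewrite E in hE; rewrite hE.
  exact: (@ge0_subset_integral _ (measurableTypeR R) R leb _ _ mE mF (fun t => (osc x t)%:E) (mo _ _)).
apply: le_trans (leeD h1 h2).
have mo2 (D : set (measurableTypeR R)) : measurable_fun D (fun t => (osc x (t + u))%:E).
  apply/measurable_EFinP.
  apply: (@measurableT_comp _ _ _ _ _ _ (osc x)); first exact: measurable_osc.
  by apply: measurable_funTS; exact: measurable_addr.
rewrite -ge0_integralD//.
apply: ge0_le_integral => //; first exact: emeasurable_funD.
move=> t _; rewrite -EFinD lee_fin /osc.
apply: min1_leD.
have -> : x + (t + u) = x + u + t by rewrite addrAC addrA.
by have := ler_distD (h (x + u + t)) (h (x + u)) (h x); rewrite [X in _ <= X + _]distrC.
Qed.

(** The convergence in the definition of slow variation is only pointwise in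
lambda; measurability makes it locally uniform. With x = ln t and u = ln (s / t),
the truncated increment of h from x to x + u is bounded by integrals that tend
to 0 by dominated convergence. *)
Lemma slowly_varying_cvg (s t : nat -> R) : t n @[n --> \oo] --> +oo ->
  s n / t n @[n --> \oo] --> (1 : R) -> ell (s n) / ell (t n) @[n --> \oo] --> (1 : R).
Proof.
move=> too st.
pose x n := ln (t n); pose u n := ln (s n / t n).
have u0 : u n @[n --> \oo] --> (0 : R).
  by rewrite -ln1; exact: (cvg_comp _ _ st (continuous_ln (@ltr01 R))).
have xoo : x n @[n --> \oo] --> +oo.
  apply/cvgryPge => A; near=> n.
  have tA : expR A <= t n by near: n; apply: cvgry_ge.
  by rewrite -(expRK A) ler_ln ?posrE ?expR_gt0// (lt_le_trans (expR_gt0 A)).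
have xuoo : x n + u n @[n --> \oo] --> +oo.
  apply/cvgryPge => A; near=> n.
  have xA : A + 1 <= x n by near: n; apply: cvgry_ge.
  have u1 : - 1 <= u n by near: n; apply: (cvgr_ge _ u0); lra.
  lra.
have osc0 : osc (x n) (u n) @[n --> \oo] --> (0 : R).
  apply: (fine_cvg (f := fun n => (osc (x n) (u n))%:E)).
  apply: (@squeeze_cvge _ _ _ _ (cst 0%E) _ (fun n => osc_integral (x n + u n) + osc_integral (x n))%E).
  - near=> n; rewrite /= lee_fin osc_ge0/=; apply: osc_le.
    near: n; apply: (cvgr_norm_le _ u0); by rewrite normr0.
  - exact: cvg_cst.
  - by rewrite -[0%:E](adde0 0%E); apply: cvgeD => //; exact: osc_integral_cvg0.
have d0 : h (x n + u n) - h (x n) @[n --> \oo] --> (0 : R).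
  apply/norm_cvg0P; apply: cvg_trans (osc0); apply: near_eq_cvg; near=> n.
  have : osc (x n) (u n) < 1 by near: n; apply: (cvgr_lt _ osc0).
  by rewrite /osc minEle; case: ifP => //; rewrite ltxx.
have := cvg_comp _ _ d0 (@continuous_expR R 0); rewrite expR0.
apply: cvg_trans; apply: near_eq_cvg; near=> n => /=.
have t0 : 0 < t n by near: n; apply: cvgry_gt.
have st0 : 0 < s n / t n by near: n; apply: (cvgr_gt _ st).
rewrite expRB /h expRD /x /u !lnK ?posrE// ?ell0//.
  by rewrite mulrCA divff ?mulr1// gt_eqF.
by rewrite mulr_gt0.
Unshelve. all: by end_near. Qed.
End slow_variation.

(** * Limits of real sequences *)

Section sequence_limits.
Context {R : realType}.
Implicit Types (f g : nat -> R) (a b : R).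

Lemma cvgn_eq f g a : (\forall n \near \oo, f n = g n) ->
  f n @[n --> \oo] --> a -> g n @[n --> \oo] --> a.
Proof. by move=> fg; apply: cvg_trans; apply: near_eq_cvg. Qed.

Lemma cvgnM f g a b : f n @[n --> \oo] --> a -> g n @[n --> \oo] --> b ->
  f n * g n @[n --> \oo] --> a * b.
Proof. by move=> fa gb; exact: cvgM. Qed.

Lemma cvgnD f g a b : f n @[n --> \oo] --> a -> g n @[n --> \oo] --> b ->
  f n + g n @[n --> \oo] --> a + b.
Proof. by move=> fa gb; exact: cvgD. Qed.

Lemma cvgnB f g a b : f n @[n --> \oo] --> a -> g n @[n --> \oo] --> b ->
  f n - g n @[n --> \oo] --> a - b.
Proof. by move=> fa gb; exact: cvgB. Qed.

Lemma cvgnZ f a b : f n @[n --> \oo] --> a -> b * f n @[n --> \oo] --> b * a.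
Proof. by move=> fa; exact: cvgMr. Qed.

Lemma cvgnV f a : a != 0 -> f n @[n --> \oo] --> a -> (f n)^-1 @[n --> \oo] --> a^-1.
Proof. by move=> a0 fa; exact: cvgV. Qed.

Lemma cvgn_cst a : (fun=> a) n @[n --> \oo] --> a.
Proof. exact: cvg_cst. Qed.

Lemma cvgn_inv f : f n @[n --> \oo] --> +oo -> (f n)^-1 @[n --> \oo] --> (0 : R).
Proof.
move=> foo; have f0 : \forall n \near \oo, 0 < f n by exact: cvgry_gt.
by have [_ /(_ foo)] := gtr0_cvgV0 f0.
Qed.

Lemma cvgn_pinftyM f a : 0 < a -> f n @[n --> \oo] --> +oo -> a * f n @[n --> \oo] --> +oo.
Proof.
move=> a0 foo; apply/cvgryPge => A; near=> n.
by rewrite mulrC -ler_pdivrMr//; near: n; exact: cvgry_ge.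
Unshelve. all: by end_near. Qed.

Lemma cvgn_squeeze f g h a : (\forall n \near \oo, f n <= g n <= h n) ->
  f n @[n --> \oo] --> a -> h n @[n --> \oo] --> a -> g n @[n --> \oo] --> a.
Proof. by move=> fgh fa ha; exact: (squeeze_cvgr fgh). Qed.

Lemma noninc_leq f m n : (forall k, f k.+1 <= f k) -> (m <= n)%N -> f n <= f m.
Proof. by move=> /nonincreasing_seqP; apply. Qed.

Lemma cvgy_trunc (t : nat -> R) : t n @[n --> \oo] --> +oo ->
  (Num.truncn (t n))%:R / t n @[n --> \oo] --> (1 : R).
Proof.
move=> too; have toV : (t n)^-1 @[n --> \oo] --> (0 : R) by exact: cvgn_inv.
apply: (@cvgn_squeeze (fun n => 1 - (t n)^-1) _ (fun=> 1)).
- near=> n; have t0 : 0 < t n by near: n; apply: cvgry_gt.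
  rewrite ler_pdivrMr// mul1r ler_pdivlMr//.
  have /andP[h1 h2] := truncn_itv (ltW t0).
  rewrite h1 andbT mulrBl mul1r mulVf ?gt_eqF// lerBlDr natr1; exact: ltW.
- by have := cvgnB (cvgn_cst (a := 1)) toV; rewrite subr0.
- exact: cvgn_cst.
Unshelve. all: by end_near. Qed.

Lemma cvg_ratio_trunc (s t : nat -> R) (y : R) : t n @[n --> \oo] --> +oo -> 0 < y ->
  s n / t n @[n --> \oo] --> y -> (Num.truncn (s n))%:R / t n @[n --> \oo] --> y.
Proof.
move=> too y0 st.
have soo : s n @[n --> \oo] --> +oo.
  apply/cvgryPge => A; near=> n.
  have t0 : 0 < t n by near: n; apply: cvgry_gt.
  have : y / 2 <= s n / t n by near: n; apply: (cvgr_ge _ st); rewrite ltr_pdivrMr// ltr_pMr// ltr1n.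
  rewrite ler_pdivlMr//; apply: le_trans.
  rewrite mulrC -ler_pdivrMr ?divr_gt0//; near: n; exact: cvgry_ge.
have := cvgnM (cvgy_trunc soo) st; rewrite mul1r; apply: cvgn_eq; near=> n => /=.
have s0 : s n != 0 by rewrite gt_eqF//; near: n; apply: cvgry_gt.
by rewrite mulrA mulfVK.
Unshelve. all: by end_near. Qed.

Lemma cvg_natr_pinfty : (n%:R : R) @[n --> \oo] --> +oo.
Proof. exact: cvgr_idn. Qed.

Lemma cvg_powR (u : nat -> R) (y p : R) : 0 < y -> u n @[n --> \oo] --> y ->
  u n `^ p @[n --> \oo] --> y `^ p.
Proof.
move=> y0 uy.
have c : {for y, continuous (fun x : R => x `^ p)}.
  apply/differentiable_continuous/derivable1_diffP.
  by apply: derivable_powR; rewrite in_itv/= y0.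
exact: (cvg_comp _ _ uy c).
Qed.
End sequence_limits.

(** * Regularly varying concave sequences *)

Lemma secant_le_algebra {F : realFieldType} (alpha h e p : F) :
  0 <= alpha -> alpha < 1 -> 0 <= h -> h < 1 -> 0 <= e -> e <= 1 -> h <= e / 2 ->
  1 - h <= p * (1 - alpha + alpha * (1 - h)) -> 1 - p <= (1 - alpha + e) * h.
Proof.
move=> a0 a1 h0 h1 e0 e1 he hp.
have ah : 0 < 1 - alpha * h by rewrite subr_gt0 mulr_ilt1.
rewrite -(ler_pM2r ah).
apply: (@le_trans _ _ ((1 - alpha) * h)); first nra.
have b0 : 0 <= alpha * (1 - alpha + e) <= 2.
  apply/andP; split; first by rewrite mulr_ge0//; lra.
  by rewrite -[leRHS]mul1r ler_pM//; lra.
have : h * (alpha * (1 - alpha + e)) <= e / 2 * 2 by case/andP: b0 => *; exact: ler_pM.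
rewrite divfK ?pnatr_eq0// => k.
have -> : (1 - alpha + e) * h * (1 - alpha * h) =
  h * (1 - alpha + e - h * (alpha * (1 - alpha + e))) by ring.
by rewrite mulrC ler_wpM2l//; lra.
Qed.

Lemma le_secant_algebra {F : realFieldType} (alpha h e p : F) :
  0 <= alpha -> alpha < 1 -> 0 <= h -> 0 <= e -> h <= e ->
  1 + h <= p * (1 - alpha + alpha * (1 + h)) -> (1 - alpha - e) * h <= p - 1.
Proof.
move=> a0 a1 h0 e0 he hp.
have ah0 : 0 <= alpha * h by rewrite mulr_ge0.
have ah : 0 < 1 + alpha * h by lra.
rewrite -(ler_pM2r ah).
apply: (@le_trans _ _ ((1 - alpha) * h)); last nra.
have k : h * (alpha * (1 - alpha)) <= e * 1.
  by rewrite ler_pM ?mulr_ge0 ?subr_ge0 ?(ltW a1)// mulr_ile1 ?subr_ge0 ?(ltW a1)// lerBlDr lerDl.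
have -> : (1 - alpha - e) * h * (1 + alpha * h) =
  h * (1 - alpha - e + h * (alpha * (1 - alpha)) - e * (alpha * h)) by ring.
rewrite [leRHS]mulrC ler_wpM2l//.
have : 0 <= e * (alpha * h) by rewrite mulr_ge0.
lra.
Qed.

Section regular_variation.
Context {R : realType}.
Variables (ell : R -> R) (alpha : R) (w : nat -> R).
Hypothesis svell : slowly_varying ell.
Hypotheses (alpha_gt0 : 0 < alpha) (alpha_lt1 : alpha < 1).
Let rho (t : R) := t `^ (1 - alpha) * ell t.
Hypothesis w_rho : w n / rho n%:R @[n --> \oo] --> (1 : R).
Let v n := w n.+1 - w n.
Hypothesis w0 : w 0 = 0.
Hypothesis v_ge0 : forall n, 0 <= v n.
Hypothesis v_dec : forall n, v n.+1 <= v n.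
Hypothesis w1_gt0 : 0 < w 1.

Lemma regvar_gt0 t : 0 < t -> 0 < rho t.
Proof. by move=> t0; rewrite mulr_gt0 ?powR_gt0 ?(slowly_varying_gt0 svell). Qed.

(** Combines the pointwise convergence ell (y t) / ell t -> 1 with
[slowly_varying_cvg], which replaces y t by the asymptotically equal integer m. *)
Lemma regvar_comp_cvg (m : nat -> nat) (t : nat -> R) (y : R) : 0 < y -> t n @[n --> \oo] --> +oo ->
  (m n)%:R / t n @[n --> \oo] --> y ->
  w (m n) / rho (t n) @[n --> \oo] --> y `^ (1 - alpha).
Proof.
move=> y0 too mt.
have mooR : ((m n)%:R : R) @[n --> \oo] --> +oo.
  apply/cvgryPge => A; near=> n.
  have t0 : 0 < t n by near: n; apply: cvgry_gt.
  have : y / 2 <= (m n)%:R / t n by near: n; apply: (cvgr_ge _ mt); rewrite ltr_pdivrMr// ltr_pMr// ltr1n.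
  rewrite ler_pdivlMr//; apply: le_trans.
  rewrite mulrC -ler_pdivrMr ?divr_gt0//; near: n; exact: cvgry_ge.
have moo : m n @[n --> \oo] --> \oo.
  apply/cvgnyPge => A; near=> n; rewrite -(ler_nat R); near: n; exact: cvgry_ge.
have h1 : w (m n) / rho (m n)%:R @[n --> \oo] --> (1 : R) by exact: (cvg_comp _ _ moo w_rho).
have ytoo : y * t n @[n --> \oo] --> +oo by exact: cvgn_pinftyM.
have h2 : ell (m n)%:R / ell (y * t n) @[n --> \oo] --> (1 : R).
  apply: (slowly_varying_cvg svell) => //.
  have := cvgnZ (b := y^-1) mt; rewrite mulVf ?gt_eqF//.
  by apply: cvgn_eq; apply: nearW => n /=; rewrite invfM mulrCA.
have h3 : ell (y * t n) / ell (t n) @[n --> \oo] --> (1 : R).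
  exact: (cvg_comp _ _ too (slowly_varyingP svell y0)).
have h4 := cvg_powR (p := 1 - alpha) y0 mt.
have := cvgnM (cvgnM h1 h4) (cvgnM h2 h3); rewrite !mul1r mulr1.
apply: cvgn_eq; near=> n => /=.
have m0 : 0 < (m n)%:R :> R by near: n; apply: cvgry_gt.
have t0 : 0 < t n by near: n; apply: cvgry_gt.
have em : ell (m n)%:R != 0 by rewrite gt_eqF// (slowly_varying_gt0 svell).
have et : ell (t n) != 0 by rewrite gt_eqF// (slowly_varying_gt0 svell).
have ey : ell (y * t n) != 0 by rewrite gt_eqF// (slowly_varying_gt0 svell)// mulr_gt0.
have pm : (m n)%:R `^ (1 - alpha) != 0 by rewrite gt_eqF// powR_gt0.
have pt : t n `^ (1 - alpha) != 0 by rewrite gt_eqF// powR_gt0.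
have -> : ((m n)%:R / t n) `^ (1 - alpha) = (m n)%:R `^ (1 - alpha) / t n `^ (1 - alpha).
  by rewrite powRM ?invr_ge0 ?(ltW t0)// -powR_inv1 ?(ltW t0)// -powRrM mulN1r powRN.
rewrite /rho; move: em et ey pm pt.
move: (ell _) (ell _) (ell _) (_ `^ _) (_ `^ _) (w _) => e1 e2 e3 p1 p2 ww a1 a2 a3 a4 a5.
by field; rewrite a1 a2 a3 a4 a5.
Unshelve. all: by end_near. Qed.

Lemma regvar_ratio_cvg (m : nat -> nat) (y : R) : 0 < y ->
  (m n)%:R / n%:R @[n --> \oo] --> y -> w (m n) / w n @[n --> \oo] --> y `^ (1 - alpha).
Proof.
move=> y0 my; have h1 := regvar_comp_cvg y0 cvg_natr_pinfty my.
have := cvgnM h1 (cvgnV (oner_neq0 R) w_rho); rewrite invr1 mulr1.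
apply: cvgn_eq; near=> n => /=.
have n0 : rho n%:R != 0 by rewrite gt_eqF// regvar_gt0// ltr0n; near: n; exact: nbhs_infty_gt.
by rewrite invf_div mulrA mulfVK.
Unshelve. all: by end_near. Qed.

Lemma concave_seq_homo : {homo w : m n / (m <= n)%N >-> m <= n}.
Proof. by apply: homo_leq => //; [exact: le_trans|move=> n; rewrite -subr_ge0 v_ge0]. Qed.

Lemma concave_seq_gt0 n : (0 < n)%N -> 0 < w n.
Proof. by move=> n0; apply: (lt_le_trans w1_gt0); exact: concave_seq_homo. Qed.

Lemma concave_increment_homo m n : (m <= n)%N -> v n <= v m.
Proof. exact: noninc_leq. Qed.

Lemma concave_seq_addn_le n k : w (n + k) <= w n + k%:R * v n.
Proof.
elim: k => [|k IH]; first by rewrite addn0 mul0r addr0.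
have := concave_increment_homo (leq_addr k n).
have -> : w (n + k.+1) = w (n + k) + v (n + k) by rewrite addnS /v addrC subrK.
move=> h; have -> : k.+1%:R * v n = k%:R * v n + v n by rewrite -natr1 mulrDl mul1r.
by rewrite [leRHS]addrA; exact: lerD.
Qed.

Lemma concave_increment_le n : n%:R * v n <= w n.
Proof.
elim: n => [|n IH]; first by rewrite mul0r w0.
have : v n.+1 * n.+1%:R <= v n * n.+1%:R by rewrite ler_wpM2r.
have -> : w n.+1 = w n + v n by rewrite /v addrC subrK.
rewrite -[n.+1%:R]natr1 mulrC => /le_trans; apply.
by rewrite mulrDr mulr1 lerD2r mulrC.
Qed.

(** A concave sequence started at 0 grows at most linearly; this gives the
integrable majorant in the Abelian theorem. *)
Lemma concave_seq_le m n : (0 < n)%N -> w m <= (1 + m%:R / n%:R) * w n.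
Proof.
move=> n0; have nR : 0 < n%:R :> R by rewrite ltr0n.
have wn := concave_seq_gt0 n0.
have [mn|nm] := leqP m n.
  apply: (le_trans (concave_seq_homo mn)); rewrite ler_peMl ?(ltW wn)//.
  by rewrite lerDl divr_ge0.
have := concave_seq_addn_le n (m - n); rewrite subnKC ?(ltnW nm)// => /le_trans; apply.
have : (m - n)%:R * v n <= m%:R / n%:R * w n.
  rewrite -mulrA ler_pM// ?ler_nat ?leq_subr// ler_pdivlMl//; exact: concave_increment_le.
by rewrite mulrDl mul1r lerD2l.
Qed.

Section laplace_transform.
Notation leb := (@lebesgue_measure R).
Implicit Types (t y : R).

(* Summation by parts turns the Laplace series into the integral over [0, +oo[ of
   this function: as w vanishes at 0, its value at the integer part of y t plus one
   is the sum of the increments of index at most y t. *)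
Let laplace_integrand t y := expR (- y) * w (Num.truncn (y * t)).+1.
Let laplace_term t k : R -> \bar R := (fun y => (v k * expR (- y))%:E) \_ `[k%:R / t, +oo[.

Lemma laplace_integrandE t y : 0 < t -> 0 <= y ->
  (laplace_integrand t y)%:E = (\sum_(k <oo) laplace_term t k y)%E.
Proof.
move=> t0 y0; apply/esym/lim_near_cst => //.
have yt0 : 0 <= y * t by rewrite mulr_ge0// ltW.
set N := (Num.truncn (y * t)).+1.
near=> n; have Nn : (N <= n)%N by near: n; exact: nbhs_infty_ge.
rewrite (@big_cat_nat _ _ _ N 0 n)//= [X in (_ + X)%E]big1_seq ?adde0; last first.
  move=> k /andP[_]; rewrite mem_index_iota => /andP[Nk _].
  rewrite /laplace_term patchE ifF//; apply/negP; rewrite inE/= in_itv/= andbT.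
  rewrite ler_pdivrMr// => kyt; have /andP[_] := truncn_itv yt0.
  by rewrite ltNge (le_trans _ kyt)// ler_nat.
rewrite (eq_big_nat _ _ (F2 := fun k => (expR (- y) * (w k.+1 - w k))%:E)); last first.
  move=> k /andP[_ kN]; rewrite /laplace_term patchE ifT ?[v k * _]mulrC//.
  rewrite inE/= in_itv/= andbT ler_pdivrMr//.
  by have /andP[+ _] := truncn_itv yt0; apply: le_trans; rewrite ler_nat.
by rewrite sumEFin -mulr_sumr telescope_sumr// w0 subr0.
Unshelve. all: by end_near. Qed.

Lemma measurable_laplace_term t k : measurable_fun [set: measurableTypeR R] (laplace_term t k).
Proof.
apply/(measurable_restrictT _ _).1 => /=; first exact: (@measurable_itv R).
apply/measurable_EFinP/measurable_funTS; apply: measurable_funM => //.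
by apply: measurableT_comp => //; exact: measurable_expR.
Qed.

Lemma laplace_term_ge0 t k y : (0 <= laplace_term t k y)%E.
Proof.
rewrite /laplace_term patchE; case: ifP => // _.
by rewrite lee_fin mulr_ge0 ?expR_ge0 ?v_ge0.
Qed.

Lemma integral_laplace_term t k : 0 < t ->
  (\int[leb]_(y in `[0%R, +oo[) laplace_term t k y = (expR (- (k%:R / t)) * v k)%:E)%E.
Proof.
move=> t0; rewrite -integral_mkcondr.
have -> : `[0, +oo[%classic `&` `[k%:R / t, +oo[%classic = `[k%:R / t, +oo[%classic :> set R.
  apply: setIidr => y /=; rewrite !in_itv/= !andbT; apply: le_trans.
  by rewrite divr_ge0// ltW.
rewrite (@ge0_continuous_FTC2y _ _ (fun y => - (v k * expR (- y))) _ 0)//.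
- by rewrite EFinN oppeK add0e mulrC.
- by move=> y _; rewrite mulr_ge0 ?expR_ge0 ?v_ge0.
- apply: continuous_subspaceT => y; apply: cvgMr.
  exact: continuous_expRN.
- rewrite -oppr0 -[X in - X](mulr0 (v k)); apply: cvgN; apply: cvgMr.
  exact: cvgr_expR.
- apply: cvg_at_right_filter; apply: cvgN; apply: cvgMr.
  exact: continuous_expRN.
- move=> y _; rewrite derive1E; apply: derive_val.
  by apply: is_derive_eq; rewrite /GRing.scale/=; ring.
Qed.

Lemma integral_laplace_integrand t : 0 < t ->
  (\int[leb]_(y in `[0%R, +oo[) (laplace_integrand t y)%:E =
   \sum_(k <oo) (expR (- (k%:R / t)) * v k)%:E)%E.
Proof.
move=> t0.
transitivity (\int[leb]_(y in `[0%R, +oo[) (\sum_(k <oo) laplace_term t k y))%E.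
  by apply: eq_integral => y; rewrite inE/= in_itv/= andbT => y0; exact: laplace_integrandE.
rewrite integral_nneseries//.
- by apply: eq_eseriesr => k _; exact: integral_laplace_term.
- by move=> k; apply: measurable_funTS; exact: measurable_laplace_term.
- by move=> k y _; exact: laplace_term_ge0.
Qed.

Lemma measurable_laplace_integrand t (D : set (measurableTypeR R)) : 0 < t -> D `<=` `[0, +oo[ ->
  measurable D -> measurable_fun D (fun y => (laplace_integrand t y)%:E).
Proof.
move=> t0 D0 mD.
apply: (eq_measurable_fun (fun y => \sum_(k <oo) laplace_term t k y)%E).
  by move=> y /[!inE] /D0; rewrite /= in_itv/= andbT => y0; rewrite laplace_integrandE.
apply: ge0_emeasurable_sum => [k y _ _|k _]; first exact: laplace_term_ge0.
by apply: measurable_funTS; exact: measurable_laplace_term.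
Qed.

(** The limit of the series is computed in the extended reals, where the
interchange of sum and integral holds by nonnegativity; finiteness of the
integral allows the return to the reals. *)
Lemma laplace_series_integral t : 0 < t ->
  (\int[leb]_(y in `[0%R, +oo[) (laplace_integrand t y)%:E)%E \is a fin_num ->
  (limn (series (fun n => expR (- (n%:R / t)) * v n)))%:E =
  (\int[leb]_(y in `[0%R, +oo[) (laplace_integrand t y)%:E)%E.
Proof.
move=> t0 fin; rewrite -(fineK fin) integral_laplace_integrand//; congr EFin.
rewrite integral_laplace_integrand// in fin.
apply: cvg_lim => //.
have : (\sum_(0 <= k < n) (expR (- (k%:R / t)) * v k)%:E)%E @[n --> \oo] -->
    (fine (\sum_(k <oo) (expR (- (k%:R / t)) * v k)%:E))%:E.
  rewrite fineK//; apply: is_cvg_nneseries => k _ _.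
  by rewrite lee_fin mulr_ge0 ?expR_ge0 ?v_ge0.
move=> /fine_cvg; apply: cvgn_eq; apply: nearW => n /=.
by rewrite sumEFin.
Qed.

Lemma laplace_integrand_le t y : 2 <= t -> w (Num.truncn t) <= 2 * rho t -> 0 <= y ->
  laplace_integrand t y <= 4 * (y `^ 0 * expR (- y)) * rho t + 4 * (y `^ 1 * expR (- y)) * rho t.
Proof.
move=> t2 wt y0.
have t0 : 0 < t by rewrite (lt_le_trans _ t2)// ltr0n.
have /andP[tr1 tr2] := truncn_itv (ltW t0).
have trh : t / 2 <= (Num.truncn t)%:R by move: tr2; rewrite -natr1; lra.
have tr0 : (0 < Num.truncn t)%N by rewrite -(ltr0n R) (lt_le_trans _ trh)// divr_gt0.
rewrite powRr0 powRr1// /laplace_integrand.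
have -> : 4 * (1 * expR (- y)) * rho t + 4 * (y * expR (- y)) * rho t =
  expR (- y) * ((2 + 2 * y) * (2 * rho t)) by ring.
rewrite ler_wpM2l ?expR_ge0//.
apply: (le_trans (concave_seq_le _ tr0)).
have yt0 : 0 <= y * t by rewrite mulr_ge0// ltW.
apply: ler_pM => //; first exact/ltW/concave_seq_gt0.
have -> : 2 + 2 * y = 1 + (1 + 2 * y) by rewrite addrA.
rewrite lerD2l ler_pdivrMr ?ltr0n//.
apply: (@le_trans _ _ ((1 + 2 * y) * (t / 2))); last first.
  by rewrite ler_wpM2l// addr_ge0// mulr_ge0.
have /andP[h1 _] := truncn_itv yt0.
have -> : (1 + 2 * y) * (t / 2) = t / 2 + y * t by field.
have th : 1 <= t / 2 by rewrite ler_pdivlMr// mul1r.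
by rewrite -natr1 addrC lerD.
Qed.

Lemma cvg_laplace_integrand (t : nat -> R) y : t n @[n --> \oo] --> +oo -> 0 < y ->
  laplace_integrand (t n) y / rho (t n) @[n --> \oo] --> y `^ (1 - alpha) * expR (- y).
Proof.
move=> too y0.
have hy : (Num.truncn (y * t n))%:R / t n @[n --> \oo] --> y.
  apply: cvg_ratio_trunc => //; apply: cvgn_eq (cvgn_cst (a := y)); near=> n.
  by rewrite mulfK// gt_eqF//; near: n; exact: cvgry_gt.
have hy1 : (Num.truncn (y * t n)).+1%:R / t n @[n --> \oo] --> y.
  have := cvgnD hy (cvgn_inv too); rewrite addr0; apply: cvgn_eq; apply: nearW => n.
  by rewrite -natr1 mulrDl mul1r.
have := cvgnZ (b := expR (- y)) (regvar_comp_cvg y0 too hy1); rewrite mulrC; apply: cvgn_eq.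
by apply: nearW => n; rewrite mulrA.
Unshelve. all: by end_near. Qed.

Lemma integrable_gammaf (x : R) : 1 <= x ->
  leb.-integrable `]0, +oo[ (fun y => (y `^ (x - 1) * expR (- y))%:E).
Proof.
move=> x1; apply/integrableP; split; first exact: measurable_gammafE.
rewrite (eq_integral (fun y : measurableTypeR R => (y `^ (x - 1) * expR (- y))%:E)); last first.
  by move=> y _; rewrite /= ger0_norm// mulr_ge0 ?powR_ge0 ?expR_ge0.
rewrite integral_itv_obnd_cbnd; last exact: measurable_gammafE.
by rewrite -GammaE// ltry.
Qed.

(** Abelian theorem. Divided by its regularly varying scale, the integrand
converges pointwise to y^(1-alpha) e^(-y), and concavity dominates it by a
multiple of (1 + y) e^(-y). *)
Theorem laplace_cvg (t : nat -> R) : t n @[n --> \oo] --> +oo ->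
  limn (series (fun k => expR (- (k%:R / t n)) * v k)) / rho (t n) @[n --> \oo] --> Gamma (2 - alpha).
Proof.
move=> too.
have tr1 : (Num.truncn (t n))%:R / t n @[n --> \oo] --> (1 : R) by exact: cvgy_trunc.
have w1 := regvar_comp_cvg ltr01 too tr1; rewrite powR1 in w1.
have : \forall n \near \oo, 2 <= t n /\ w (Num.truncn (t n)) / rho (t n) <= 2.
  near=> n; split; first by near: n; exact: cvgry_ge.
  by near: n; apply: (cvgr_le _ w1); rewrite ltr1n.
move=> [N _ hN].
pose t' n := t (n + N)%N.
have t'2 n : 2 <= t' n by have [] := hN (n + N)%N (leq_addl _ _).
have t'0 n : 0 < t' n by rewrite (lt_le_trans _ (t'2 n))// ltr0n.
have rho0 n : 0 < rho (t' n) by exact: regvar_gt0.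
have wt' n : w (Num.truncn (t' n)) <= 2 * rho (t' n).
  by rewrite -ler_pdivrMr//; have [] := hN (n + N)%N (leq_addl _ _).
have t'oo : t' n @[n --> \oo] --> +oo by rewrite cvg_shiftn.
suff : limn (series (fun k => expR (- (k%:R / t' n)) * v k)) / rho (t' n) @[n --> \oo] --> Gamma (2 - alpha).
  by rewrite (cvg_shiftn N (fun n => limn (series (fun k => expR (- (k%:R / t n)) * v k)) / rho (t n))).
pose f n y := (laplace_integrand (t' n) y / rho (t' n))%:E.
have mD : measurable (`]0, +oo[%classic : set (measurableTypeR R)) by exact: measurable_itv.
have D0 : (`]0, +oo[%classic : set R) `<=` `[0, +oo[%classic.
  by move=> y /=; rewrite !in_itv/= !andbT; exact: ltW.
have mf n : measurable_fun (`]0, +oo[%classic : set (measurableTypeR R)) (f n).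
  apply/measurable_EFinP; apply: measurable_funM => //.
  by apply/measurable_EFinP; exact: measurable_laplace_integrand.
pose g (y : R) := (y `^ (2 - alpha - 1) * expR (- y))%:E.
have mg : measurable_fun (`]0, +oo[%classic : set (measurableTypeR R)) g by exact: measurable_gammafE.
have fg : {ae leb, forall y, `]0, +oo[%classic y -> f n y @[n --> \oo] --> g y}.
  apply: aeW => y; rewrite /= in_itv/= andbT => y0; apply/cvg_EFin; first exact: nearW.
  have -> : 2 - alpha - 1 = 1 - alpha by lra.
  exact: cvg_laplace_integrand.
pose h (y : R) := (4%:E * (y `^ (1 - 1) * expR (- y))%:E + 4%:E * (y `^ (2 - 1) * expR (- y))%:E)%E.
have ih : leb.-integrable `]0, +oo[ h.
  by apply: integrableD => //; apply: integrableZl => //; apply: integrable_gammaf; rewrite ?ler1n.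
have fh : {ae leb, forall y n, `]0, +oo[%classic y -> (`|f n y| <= h y)%E}.
  apply: aeW => y n; rewrite /= in_itv/= andbT => y0.
  rewrite /h /= -!EFinM -EFinD lee_fin ger0_norm; last first.
    by rewrite divr_ge0 ?(ltW (rho0 n))// mulr_ge0 ?expR_ge0// ltW// concave_seq_gt0.
  rewrite ler_pdivrMr// subrr (_ : 2 - 1 = 1 :> R); last by lra.
  by rewrite mulrDl; apply: laplace_integrand_le => //; exact: ltW.
have [_ _] := dominated_convergence mD mf mg fg ih fh.
rewrite /g integral_itv_obnd_cbnd; last exact: measurable_gammafE.
have x1 : 1 <= 2 - alpha by rewrite lerBrDr -lerBrDl -[leRHS]/(1 + 1 - 1) addrK ltW.
rewrite -(GammaE x1).
have fE n : (\int[leb]_(x in `[0%R, +oo[) (laplace_integrand (t' n) x)%:E =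
    (rho (t' n))%:E * \int[leb]_(x in `]0%R, +oo[) f n x)%E.
  rewrite -integral_itv_obnd_cbnd; last exact: measurable_laplace_integrand.
  rewrite -ge0_integralZl_EFin//.
  - apply: eq_integral => y _; rewrite -EFinM; congr EFin.
    by rewrite mulrC divfK// gt_eqF.
  - move=> y; rewrite /= in_itv/= andbT => y0.
    by rewrite lee_fin divr_ge0 ?(ltW (rho0 n))// mulr_ge0 ?expR_ge0// ltW// concave_seq_gt0.
  - exact/ltW.
move=> hl; apply: cvgn_eq (fine_cvg hl); near=> n.
have fn : (\int[leb]_(x in `]0%R, +oo[) f n x)%E \is a fin_num by near: n; exact: (cvg_is_fine hl).
have Jn : (\int[leb]_(x in `[0%R, +oo[) (laplace_integrand (t' n) x)%:E)%E \is a fin_num by rewrite fE fin_numM.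
have -> : limn (series (fun k => expR (- (k%:R / t' n)) * v k)) = fine (\int[leb]_(x in `[0%R, +oo[) (laplace_integrand (t' n) x)%:E)%E.
  by apply: EFin_inj; rewrite fineK// laplace_series_integral.
by rewrite fE fineM//= mulrAC divff ?mul1r// gt_eqF.
Unshelve. all: by end_near. Qed.
End laplace_transform.

(** The hypotheses are those satisfied by the measure of few visits: monotonicity
in time, and two-sided bounds on its sums. *)
Section monotone_density.
Variables (F : nat -> nat -> R) (C : R).
Hypothesis C_ge0 : 0 <= C.
Hypothesis F_noninc : forall J j, F J j.+1 <= F J j.
Let V J N := \sum_(j < N) F J j.
Hypothesis V_up : forall J N, V J N <= J.+1%:R * w N.
Hypothesis V_lo : forall J N M, (0 < M <= N)%N ->
  J.+1%:R * (w N - C * w N.+1 * (J.+1%:R * w M / M%:R) - (w N.+1 - w (N - M).+1)) <= V J N.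
Variable J : nat -> nat.
Let q n := (J n).+1%:R * w n / n%:R.
Hypothesis q0 : q n @[n --> \oo] --> (0 : R).

Lemma scale_gt0 n : (0 < n)%N -> 0 < q n.
Proof. by move=> n0; rewrite divr_gt0 ?ltr0n// mulr_gt0// concave_seq_gt0. Qed.

Lemma sqrt_scale_cvg0 : Num.sqrt (q n) @[n --> \oo] --> (0 : R).
Proof. by rewrite -[X in _ --> X](@sqrtr0 R); apply: (cvg_comp _ _ q0 (@sqrt_continuous R 0)). Qed.

(* The window length balances the two errors in the lower bound: M / n -> 0 makes
   the last increment of w negligible, and q n * n / M <= sqrt (q n) -> 0 the
   first one. *)
Let M n := (Num.truncn (n%:R * Num.sqrt (q n))).+1.

Lemma window_cvg0 : (M n)%:R / n%:R @[n --> \oo] --> (0 : R).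
Proof.
have noo : (n%:R^-1 : R) @[n --> \oo] --> (0 : R) by exact/cvgn_inv/cvg_natr_pinfty.
have h := cvgnD sqrt_scale_cvg0 noo; rewrite addr0 in h.
apply: (cvgn_squeeze _ (cvgn_cst (a := 0)) h); near=> n.
have n0 : 0 < n%:R :> R by rewrite ltr0n; near: n; exact: nbhs_infty_gt.
rewrite divr_ge0//= ler_pdivrMr// mulrDl mulVf ?gt_eqF// /M -natr1 lerD2r mulrC.
by have /andP[] := truncn_itv (mulr_ge0 (sqrtr_ge0 (q n)) (ltW n0)).
Unshelve. all: by end_near. Qed.

(** The upper bound is regular variation alone; in the lower bound the window
makes both error terms negligible with respect to w. *)
Lemma partial_sum_cvg (N : nat -> nat) (x : R) : 0 < x -> (N n)%:R / n%:R @[n --> \oo] --> x ->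
  V (J n) (N n) / ((J n).+1%:R * w n) @[n --> \oo] --> x `^ (1 - alpha).
Proof.
move=> x0 Nx.
have noo : (n%:R^-1 : R) @[n --> \oo] --> (0 : R) by exact/cvgn_inv/cvg_natr_pinfty.
have e1 := regvar_ratio_cvg x0 Nx.
have N1x : (N n).+1%:R / n%:R @[n --> \oo] --> x.
  have := cvgnD Nx noo; rewrite addr0; apply: cvgn_eq; apply: nearW => n.
  by rewrite -natr1 mulrDl mul1r.
have e2 := regvar_ratio_cvg x0 N1x.
have MN : \forall n \near \oo, (M n <= N n)%N.
  near=> n; have n0 : 0 < n%:R :> R by rewrite ltr0n; near: n; exact: nbhs_infty_gt.
  rewrite -(ler_nat R) -(ler_pM2r (_ : 0 < n%:R^-1)) ?invr_gt0//.
  apply: (@le_trans _ _ (x / 2)).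
    by near: n; apply: (cvgr_le _ window_cvg0); rewrite divr_gt0.
  by near: n; apply: (cvgr_ge _ Nx); rewrite ltr_pdivrMr// ltr_pMr// ltr1n.
have NMx : (N n - M n).+1%:R / n%:R @[n --> \oo] --> x.
  have := cvgnD (cvgnB Nx window_cvg0) noo; rewrite subr0 addr0; apply: cvgn_eq; near=> n.
  rewrite -natr1 natrB; first by rewrite mulrDl mulrBl mul1r.
  by near: n.
have e3 := regvar_ratio_cvg x0 NMx.
have e5 := cvgnM (cvgnZ (b := C) e2) sqrt_scale_cvg0.
have lo := cvgnB (cvgnB e1 e5) (cvgnB e2 e3).
rewrite mulr0 subrr !subr0 in lo.
apply: (cvgn_squeeze _ lo e1); near=> n.
have n0 : (0 < n)%N by near: n; exact: nbhs_infty_gt.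
have nR : 0 < n%:R :> R by rewrite ltr0n.
have wn := concave_seq_gt0 n0.
have J0 : 0 < (J n).+1%:R :> R by rewrite ltr0n.
have Jw : 0 < (J n).+1%:R * w n by rewrite mulr_gt0.
have MNn : (0 < M n <= N n)%N by rewrite /=; near: n.
have Mn : (M n <= n)%N.
  rewrite -(ler_nat R) -[leRHS]mul1r -ler_pdivrMr//.
  by near: n; apply: (cvgr_le _ window_cvg0).
rewrite ler_pdivlMr// ler_pdivrMr//; apply/andP; split; last first.
  by apply: (le_trans (V_up _ _)); rewrite mulrCA -mulrA mulVf ?mulr1// gt_eqF.
apply: le_trans (V_lo _ MNn).
rewrite [leLHS]mulrC -[leLHS]mulrA ler_pM2l//.
have -> : w n * (w (N n) / w n - C * (w (N n).+1 / w n) * Num.sqrt (q n) -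
    (w (N n).+1 / w n - w (N n - M n).+1 / w n)) =
  w (N n) - C * w (N n).+1 * Num.sqrt (q n) - (w (N n).+1 - w (N n - M n).+1).
  by move: wn; move: (w n) (w _) (w _) (w _) (Num.sqrt _) => a b c d e a0; field; rewrite gt_eqF.
rewrite lerD2r lerD2l lerN2 ler_wpM2l//.
  by rewrite mulr_ge0// ltW// concave_seq_gt0.
have qn := scale_gt0 n0.
have sq : 0 < Num.sqrt (q n) by rewrite sqrtr_gt0.
have M0 : 0 < (M n)%:R :> R by rewrite ltr0n.
apply: (@le_trans _ _ ((J n).+1%:R * w n / (M n)%:R)).
  by rewrite ler_pM2r ?invr_gt0// ler_pM2l//; exact: concave_seq_homo.
rewrite ler_pdivrMr//.
have -> : (J n).+1%:R * w n = Num.sqrt (q n) * (n%:R * Num.sqrt (q n)).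
  by rewrite mulrCA -expr2 sqr_sqrtr ?(ltW qn)// /q [RHS]mulrC divfK// gt_eqF.
rewrite ler_pM2l// /M ltW//.
by have /andP[] := truncn_itv (mulr_ge0 (ltW nR) (ltW sq)).
Unshelve. all: by end_near. Qed.

Lemma partial_sum_increment J' m n : (m <= n)%N ->
  (n - m)%:R * F J' n <= V J' n - V J' m <= (n - m)%:R * F J' m.
Proof.
move=> mn; rewrite /V -!(big_mkord xpredT (F J')) (@big_cat_nat _ _ _ m 0 n)//=.
rewrite [X in _ <= X <= _]addrAC subrr add0r; apply/andP; split.
  rewrite mulr_natl -sumr_const_nat.
  apply: ler_sum_nat => i /andP[mi ni]; by apply: noninc_leq => //; exact: ltnW.
rewrite mulr_natl -sumr_const_nat.
by apply: ler_sum_nat => i /andP[mi ni]; exact: noninc_leq.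
Qed.

Lemma partial_sum_secant_cvg (N : nat -> nat) (x : R) : 0 < x -> x != 1 ->
  (N n)%:R / n%:R @[n --> \oo] --> x ->
  (V (J n) (N n) - V (J n) n) / ((J n).+1%:R * w n) / ((N n)%:R / n%:R - 1) @[n --> \oo] -->
  (x `^ (1 - alpha) - 1) / (x - 1).
Proof.
move=> x0 x1 Nx.
have N1 : n%:R / n%:R @[n --> \oo] --> (1 : R).
  apply: cvgn_eq (cvgn_cst (a := 1)); near=> n; rewrite divff// pnatr_eq0 -lt0n.
  near: n; exact: nbhs_infty_gt.
have h1 := partial_sum_cvg x0 Nx; have h2 := partial_sum_cvg ltr01 N1; rewrite powR1 in h2.
have h3 : (N n)%:R / n%:R - 1 @[n --> \oo] --> x - 1 by exact: cvgnB (cvgn_cst (a := 1)).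
have x10 : x - 1 != 0 by rewrite subr_eq0.
have := cvgnM (cvgnB h1 h2) (cvgnV x10 h3); apply: cvgn_eq; apply: nearW => n.
by rewrite -mulrBl.
Unshelve. all: by end_near. Qed.

Lemma trunc_natM_cvg (x : R) : 0 < x -> (Num.truncn (x * n%:R))%:R / n%:R @[n --> \oo] --> x.
Proof.
move=> x0; apply: cvg_ratio_trunc => //; first exact: cvg_natr_pinfty.
apply: cvgn_eq (cvgn_cst (a := x)); near=> n; rewrite mulfK// pnatr_eq0 -lt0n.
near: n; exact: nbhs_infty_gt.
Unshelve. all: by end_near. Qed.

(** This is x^alpha <= 1 - alpha + alpha x multiplied by x^(1-alpha). It bounds
x^(1-alpha) from below by a rational function with the same tangent at 1, which
controls the secant slopes there. *)
Lemma le_powR_affine (x : R) : 0 < x -> x <= x `^ (1 - alpha) * (1 - alpha + alpha * x).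
Proof.
move=> x0.
have e : x `^ (1 - alpha) * x `^ alpha = x.
  rewrite -powRD; first by rewrite subrK powRr1// ltW.
  by apply/implyP => _; rewrite gt_eqF.
rewrite -[leLHS]e.
rewrite ler_pM2l ?powR_gt0//; apply: powR_le_affine => //.
by rewrite (ltW alpha_gt0) (ltW alpha_lt1).
Qed.

Lemma powR_secant_le (h e : R) : 0 < h < 1 -> 0 < e <= 1 -> h <= e / 2 ->
  ((1 - h) `^ (1 - alpha) - 1) / (1 - h - 1) <= (1 - alpha) + e.
Proof.
move=> /andP[h0 h1] /andP[e0 e1] he; have := @le_powR_affine (1 - h) ltac:(by rewrite subr_gt0).
move: (_ `^ _) => p hp.
have -> : 1 - h - 1 = - h by rewrite addrAC subrr add0r.
rewrite invrN mulrN -mulNr opprB ler_pdivrMr//.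
by apply: secant_le_algebra hp; rewrite // ?ltW.
Qed.

Lemma le_powR_secant (h e : R) : 0 < h -> 0 < e -> h <= e ->
  (1 - alpha) - e <= ((1 + h) `^ (1 - alpha) - 1) / (1 + h - 1).
Proof.
move=> h0 e0 he; have := @le_powR_affine (1 + h) ltac:(by rewrite addr_gt0).
move: (_ `^ _) => p hp.
have -> : 1 + h - 1 = h by rewrite addrAC subrr add0r.
rewrite ler_pdivlMr//.
by apply: le_secant_algebra hp; rewrite // ltW.
Qed.

(** As F is nonincreasing in time, n F(n) is at most the backward and at least the
forward difference quotient of the sums in the variable N / n at 1. Divided by
(J + 1) w n, these quotients converge to secant slopes of x^(1-alpha) at 1,
which are within any given e of 1 - alpha for a small step h. *)
Theorem monotone_density : F (J n) n / q n @[n --> \oo] --> (1 - alpha).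
Proof.
apply/cvgrPdist_le => e e0.
pose h := Num.min 2^-1 (e / 4).
have h0 : 0 < h by rewrite lt_min invr_gt0 ltr0n divr_gt0.
have h2 : h <= 2^-1 by rewrite ge_min lexx.
have he : h <= e / 4 by rewrite ge_min lexx orbT.
have hm0 : 0 < 1 - h by lra.
have hp0 : 0 < 1 + h by lra.
have um := partial_sum_secant_cvg hm0 (_ : _ != 1) (trunc_natM_cvg hm0).
have up := partial_sum_secant_cvg hp0 (_ : _ != 1) (trunc_natM_cvg hp0).
have {}um := um ltac:(by rewrite lt_eqF//; lra).
have {}up := up ltac:(by rewrite gt_eqF//; lra).
have bm : ((1 - h) `^ (1 - alpha) - 1) / (1 - h - 1) < (1 - alpha) + e.
  apply: (@le_lt_trans _ _ (1 - alpha + Num.min 1 (e / 2))).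
    have m0 : 0 < Num.min 1 (e / 2) by rewrite lt_min ltr01 divr_gt0.
    have m1 : Num.min 1 (e / 2) <= 1 by rewrite ge_min lexx.
    have hm : h <= Num.min 1 (e / 2) / 2.
      by rewrite ler_pdivlMr// le_min; apply/andP; split; lra.
    apply: powR_secant_le => //; last exact/andP.
    by apply/andP; split => //; lra.
  by rewrite ltrD2l gt_min ltr_pdivrMr// ltr_pMr// ltr1n orbT.
have bp : (1 - alpha) - e < ((1 + h) `^ (1 - alpha) - 1) / (1 + h - 1).
  apply: lt_le_trans (_ : 1 - alpha - e / 2 <= _); last by apply: le_powR_secant; lra.
  by rewrite ltrD2l ltrN2 ltr_pdivrMr// ltr_pMr// ltr1n.
near=> n.
have n0 : (0 < n)%N by near: n; exact: nbhs_infty_gt.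
have nR : 0 < n%:R :> R by rewrite ltr0n.
have Jw : 0 < (J n).+1%:R * w n by rewrite mulr_gt0// concave_seq_gt0.
have qE : F (J n) n / q n = n%:R * F (J n) n / ((J n).+1%:R * w n).
  by rewrite /q invf_div; rewrite mulrCA mulrA.
rewrite ler_distlC; apply/andP; split.
- have Nn : 1 < (Num.truncn ((1 + h) * n%:R))%:R / n%:R :> R.
    near: n; apply: (cvgr_gt _ (trunc_natM_cvg hp0)); lra.
  have upn : 1 - alpha - e <= (V (J n) (Num.truncn ((1 + h) * n%:R)) - V (J n) n) /
      ((J n).+1%:R * w n) / ((Num.truncn ((1 + h) * n%:R))%:R / n%:R - 1).
    by near: n; apply: (cvgr_ge _ up).
  move: Nn upn; set N := Num.truncn _ => Nn upn.
  have nN : (n < N)%N by move: Nn; rewrite ltr_pdivlMr// mul1r ltr_nat.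
  apply: (@le_trans _ _ ((V (J n) N - V (J n) n) / ((J n).+1%:R * w n) / (N%:R / n%:R - 1))).
    exact: upn.
  rewrite qE ler_pdivrMr ?subr_gt0// mulrAC ler_pM2r ?invr_gt0//.
  have /andP[_] := partial_sum_increment (J n) (ltnW nN).
  rewrite natrB ?(ltnW nN)// => /le_trans; apply.
  by rewrite mulrAC mulrBr mulr1 mulrCA divff ?gt_eqF// mulr1.
- have Nn : (Num.truncn ((1 - h) * n%:R))%:R / n%:R < 1 :> R.
    near: n; apply: (cvgr_lt _ (trunc_natM_cvg hm0)); lra.
  have umn : (V (J n) (Num.truncn ((1 - h) * n%:R)) - V (J n) n) /
      ((J n).+1%:R * w n) / ((Num.truncn ((1 - h) * n%:R))%:R / n%:R - 1) <= 1 - alpha + e.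
    by near: n; apply: (cvgr_le _ um).
  move: Nn umn; set N := Num.truncn _ => Nn umn.
  have nN : (N < n)%N by move: Nn; rewrite ltr_pdivrMr// mul1r ltr_nat.
  apply: (@le_trans _ _ ((V (J n) N - V (J n) n) / ((J n).+1%:R * w n) / (N%:R / n%:R - 1))); last first.
    exact: umn.
  rewrite qE ler_ndivlMr ?subr_lt0// mulrAC ler_pM2r ?invr_gt0//.
  have /andP[+ _] := partial_sum_increment (J n) (ltnW nN).
  rewrite natrB ?(ltnW nN)// => k; rewrite -lerN2 opprB; apply: le_trans k.
  by rewrite -mulrN opprB mulrAC mulrBr mulr1 mulrCA divff ?gt_eqF// mulr1.
Unshelve. all: by end_near. Qed.
End monotone_density.
End regular_variation.

(** * Counting visits to Y *)

Section visits.
Context {d : measure_display} {X : measurableType d} {R : realType}.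
Variables (mu : {measure set X -> \bar R}) (T : X -> X) (Y : set X).
Hypothesis mT : measurable_fun setT T.
Hypothesis muT : forall A, measurable A -> mu (T @^-1` A) = mu A.
Hypothesis mY : measurable Y.
Hypothesis muY_fin : (mu Y < +oo)%E.

(** The recursion is along T, not along the last step, because invariance of the
measure is used in the form mu (T^-1 A) = mu A. *)
Fixpoint visits n (x : X) : nat :=
  if n is m.+1 then ((T x \in Y) + visits m (T x))%N else 0.

Lemma occupationE n x : occupation T Y n x = (visits n x)%:R :> R.
Proof.
rewrite /occupation; elim: n x => [x|n IH x]; first by rewrite big_geq.
rewrite big_nat_recl// /= natrD -IH; congr (_ + _).
by apply: eq_bigr => k _; rewrite -iterSr.
Qed.

Lemma visitsD k m x : visits (k + m) x = (visits k x + visits m (iter k T x))%N.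
Proof.
by elim: k x => [//|k IH] x; rewrite addSn [LHS]/= IH [visits k.+1 x]/= iterSr addnA.
Qed.

Lemma leq_visits m n x : (m <= n)%N -> (visits m x <= visits n x)%N.
Proof. by move=> /subnKC <-; rewrite visitsD leq_addr. Qed.

Lemma visits_eq0P n x :
  reflect (forall k, (0 < k <= n)%N -> ~ Y (iter k T x)) (visits n x == 0)%N.
Proof.
apply: (iffP idP) => [/eqP v0 k /andP[k0 kn] Yk|].
  have := leq_visits x kn; rewrite v0 leqn0 -{1}(prednK k0) -addn1 visitsD/= addn0.
  by rewrite addn_eq0 -iterS prednK// mem_set// andbF.
elim: n x => [//|n IH] x h /=; rewrite addn_eq0 IH ?andbT.
  by apply/eqP; rewrite memNset//; exact: (h 1).
by move=> k /andP[k0 kn]; rewrite -iterSr; apply: h.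
Qed.

Lemma measurable_visits n (P : pred nat) : measurable [set x | P (visits n x)].
Proof.
have mTA A : measurable A -> measurable (T @^-1` A).
  by move=> mA; rewrite -[_ @^-1` _]setTI; exact: mT.
elim: n P => [|n IH] P /=.
  case: (P 0); first by rewrite (_ : [set _ | _] = setT)//; apply/seteqP; split.
  by rewrite (_ : [set _ | _] = set0)//; apply/seteqP; split.
have -> : [set x | P ((T x \in Y) + visits n (T x))%N] =
    T @^-1` ((Y `&` [set x | P (visits n x).+1]) `|` (~` Y `&` [set x | P (visits n x)])).
  apply/seteqP; split => x /=.
    by case: (boolP (T x \in Y)) => [/set_mem h|/negP h]; [left|right; split => // /mem_set].
  by case=> -[]; [move=> /mem_set->|move=> h; rewrite memNset].
by apply: mTA; apply: measurableU; apply: measurableI => //; [exact: (IH (fun k => P k.+1))|exact: measurableC].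
Qed.

Lemma mu_fin_subY A : measurable A -> mu (Y `&` A) \is a fin_num.
Proof.
move=> mA; rewrite ge0_fin_numE//; apply: le_lt_trans muY_fin.
by apply: le_measure; rewrite ?inE//; exact: measurableI.
Qed.

(** The set on the left is the preimage under T of {visits n > i} together with
the disjoint set Y ∩ {visits n = i}. *)
Lemma mu_visits_gtS n i : mu [set x | (i < visits n.+1 x)%N] =
  (mu [set x | (i < visits n x)%N] + mu (Y `&` [set x | visits n x == i]))%E.
Proof.
have m1 := measurable_visits n (fun k => (i < k)%N).
have m2 := measurableI _ _ mY (measurable_visits n (fun k => (k == i)%N)).
rewrite -measureU//; last first.
  by apply/seteqP; split => x //= -[iv [_ /eqP vi]]; rewrite vi ltnn in iv.
rewrite -[RHS]muT; last exact: measurableU m1 m2.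
congr (mu _); apply/seteqP; split => x /=.
  case: (boolP (T x \in Y)) => [/set_mem Yx|_]; last by left.
  by rewrite add1n ltnS leq_eqVlt eq_sym => /orP[|]; [right|left].
case=> [h|[Yx /eqP->]]; first by rewrite ltn_addl.
by rewrite mem_set// add1n.
Qed.

Lemma mu_visits_gt n i : mu [set x | (i < visits n x)%N] =
  (\sum_(j < n) mu (Y `&` [set x | visits j x == i]))%E.
Proof.
elim: n => [|n IH].
  by rewrite big_ord0 (_ : [set _ | _] = set0) ?measure0//; apply/seteqP; split.
by rewrite big_ord_recr/= mu_visits_gtS IH.
Qed.

Lemma mu_visits_gt_fin n i : mu [set x | (i < visits n x)%N] \is a fin_num.
Proof.
rewrite mu_visits_gt; apply/sum_fin_numP => j _ _.
exact/mu_fin_subY/(measurable_visits _ (fun k => k == i)).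
Qed.

Definition hitting_set n := \bigcup_(k < n) (iter k T @^-1` Y).

Lemma preimage_visits n : T @^-1` hitting_set n = [set x | (0 < visits n x)%N].
Proof.
apply/seteqP; split => x /=.
  move=> [k /= kn]; rewrite -iterSr => Yk; rewrite lt0n; apply/negP => /visits_eq0P.
  by move=> /(_ k.+1); rewrite ltnS => /(_ kn); exact.
rewrite lt0n => /negP v0; apply: contrapT => h; apply: v0; apply/visits_eq0P.
move=> [//|k] /= kn Yk; apply: h; exists k => //.
by rewrite /preimage/= -iterSr.
Qed.

Lemma measurable_iter k A : measurable A -> measurable (iter k T @^-1` A).
Proof.
elim: k => [//|k IH] mA; rewrite (_ : _ @^-1` _ = T @^-1` (iter k T @^-1` A)).
  by rewrite -[X in measurable X]setTI; apply: mT => //; exact: IH.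
by apply/seteqP; split => x; rewrite /preimage/= -iterSr.
Qed.

Lemma measurable_hitting_set n : measurable (hitting_set n).
Proof. by apply: bigcup_measurable => k _; exact: measurable_iter. Qed.

Lemma mu_hitting_set n : mu (hitting_set n) = mu [set x | (0 < visits n x)%N].
Proof. by rewrite -preimage_visits muT//; exact: measurable_hitting_set. Qed.

Lemma wandering_rateE n :
  (wandering_rate mu T Y n)%:E = mu [set x | (0 < visits n x)%N].
Proof. by rewrite /wandering_rate -/(hitting_set n) mu_hitting_set fineK// mu_visits_gt_fin. Qed.

Definition few_visits J n : R := fine (mu (Y `&` [set x | (visits n x <= J)%N])).

Lemma few_visitsE J n : (few_visits J n)%:E = mu (Y `&` [set x | (visits n x <= J)%N]).
Proof. by rewrite fineK//; exact/mu_fin_subY/(measurable_visits _ (fun k => k <= J)%N). Qed.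

Lemma few_visits_ge0 J n : 0 <= few_visits J n.
Proof. exact: fine_ge0. Qed.

Lemma few_visits_noninc J n : few_visits J n.+1 <= few_visits J n.
Proof.
rewrite -lee_fin !few_visitsE; apply: le_measure; rewrite ?inE.
- by apply: measurableI => //; exact: (measurable_visits _ (fun k => k <= J)%N).
- by apply: measurableI => //; exact: (measurable_visits _ (fun k => k <= J)%N).
- by move=> x [Yx v]; split => //; exact: leq_trans (leq_visits _ (leqnSn n)) v.
Qed.

Local Notation w := (wandering_rate mu T Y).

Lemma wandering_rate0 : w 0 = 0.
Proof. by apply: EFin_inj; rewrite wandering_rateE mu_visits_gt big_ord0. Qed.

Lemma wandering_rate_diff n : w n.+1 - w n = few_visits 0 n.
Proof.
apply: EFin_inj; rewrite EFinB !wandering_rateE mu_visits_gtS few_visitsE.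
rewrite addeAC subee ?mu_visits_gt_fin// add0e.
by congr (mu (_ `&` _)); apply/seteqP; split => x /=; rewrite leqn0.
Qed.

(** Sum [mu_visits_gt] over i <= J and exchange the summations. *)
Lemma sum_few_visits J N : (\sum_(j < N) (few_visits J j)%:E =
  \sum_(i < J.+1) mu [set x | (i < visits N x)%N])%E.
Proof.
transitivity (\sum_(j < N) \sum_(i < J.+1) mu (Y `&` [set x | visits j x == i]))%E; last first.
  by rewrite exchange_big; apply: eq_bigr => i _; rewrite mu_visits_gt.
apply: eq_bigr => j _; rewrite few_visitsE.
elim: J => [|J IH].
  rewrite big_ord1; congr (mu (_ `&` _)).
  by apply/seteqP; split => x /=; rewrite leqn0.
rewrite big_ord_recr/= -IH -measureU.
- congr (mu _); apply/seteqP; split => x /=.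
    by move=> [Yx]; rewrite leq_eqVlt ltnS => /orP[|]; [right|left].
  by case=> -[Yx]; [split => //; exact: leqW|move=> /eqP ->].
- by apply: measurableI => //; exact: (measurable_visits _ (fun k => k <= J)%N).
- by apply: measurableI => //; exact: (measurable_visits _ (fun k => k == J.+1)%N).
- by apply/seteqP; split => x //= -[[_ vJ] [_ /eqP vE]]; rewrite vE ltnn in vJ.
Qed.

Lemma sum_few_visits_le J N : \sum_(j < N) few_visits J j <= J.+1%:R * w N.
Proof.
rewrite -lee_fin -sumEFin sum_few_visits.
have -> : (J.+1%:R * w N)%:E = (\sum_(i < J.+1) (w N)%:E)%E.
  by rewrite sumEFin sumr_const card_ord mulr_natl.
apply: lee_sum => i _; rewrite wandering_rateE; apply: le_measure; rewrite ?inE.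
- exact: (measurable_visits _ (fun k => i < k)%N).
- exact: (measurable_visits _ (fun k => 0 < k)%N).
- by move=> x /=; apply: leq_ltn_trans.
Qed.

Lemma sum_few_visits_ge J N :
  J.+1%:R * (w N - fine (mu [set x | (0 < visits N x <= J)%N])) <= \sum_(j < N) few_visits J j.
Proof.
have mgt i := measurable_visits N (fun k => i < k)%N.
have m0J := measurable_visits N (fun k => 0 < k <= J)%N.
have fin0J : mu [set x | (0 < visits N x <= J)%N] \is a fin_num.
  rewrite ge0_fin_numE//; have := mu_visits_gt_fin N 0; rewrite ge0_fin_numE//.
  apply: le_lt_trans; apply: le_measure; rewrite ?inE//.
  by move=> x /= /andP[].
rewrite -lee_fin -sumEFin sum_few_visits EFinM EFinB wandering_rateE fineK//.
have -> : (mu [set x | (0 < visits N x)%N] - mu [set x | (0 < visits N x <= J)%N] =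
    mu [set x | (J < visits N x)%N])%E.
  have -> : [set x | (0 < visits N x)%N] =
      [set x | (0 < visits N x <= J)%N] `|` [set x | (J < visits N x)%N].
    apply/seteqP; split => x /=.
      by case: (leqP (visits N x) J) => [h v0|]; [left; rewrite v0|right].
    by case=> [/andP[]//|]; apply: leq_ltn_trans.
  rewrite measureU//; first by rewrite addeAC subee// add0e.
  by apply/seteqP; split => x //= -[/andP[_ a] b]; rewrite leqNgt b in a.
rewrite -(fineK (mu_visits_gt_fin N J)) -EFinM mulr_natl.
have -> : ((fine (mu [set x | (J < visits N x)%N])) *+ J.+1)%:E =
    (\sum_(i < J.+1) mu [set x | (J < visits N x)%N])%E.
  rewrite -(fineK (mu_visits_gt_fin N J)) sumEFin sumr_const card_ord//=.
apply: lee_sum => i _; apply: le_measure; rewrite ?inE//.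
by move=> x /=; apply: leq_ltn_trans; rewrite -ltnS.
Qed.

Lemma return_timeE n x : (0 < n)%N -> Y (iter n T x) ->
  (forall k, (0 < k < n)%N -> ~ Y (iter k T x)) -> return_time R T Y x = n%:R%:E.
Proof.
move=> n0 Yn hn; apply/eqP; rewrite eq_le; apply/andP; split.
  by apply: ereal_inf_lbound; exists n.
apply: le_ereal_inf_tmp => _ [k [k0 Yk] <-]; rewrite lee_fin ler_nat leqNgt.
by apply/negP => kn; apply: (hn k) => //; rewrite k0.
Qed.

(** Points of level n are those whose orbit is in Y for the first time at time n,
time 0 included. Thus the levels are the successive differences of the sets
whose measures are the wandering rates. *)
Lemma levelE n : level R T Y n = hitting_set n.+1 `\` hitting_set n.
Proof.
case: n => [|n].
  apply/seteqP; split => x; first by move=> Yx; split; [exists 0|case].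
  by move=> [[k /=]]; rewrite ltnS leqn0 => /eqP->.
apply/seteqP; split => x /=.
  move=> [Yx /= rx].
  have [k [k0 Yk]] : exists k, (0 < k)%N /\ Y (iter k T x).
    apply: contrapT => h; move: rx; rewrite /return_time.
    rewrite (_ : [set _ | _ in _] = set0) ?ereal_inf0//.
    by apply/seteqP; split => // y [k hk _]; apply: h; exists k.
  have ex : exists k, (0 < k)%N && (iter k T x \in Y).
    by exists k; rewrite k0 mem_set.
  case: (ex_minnP ex) => m /andP[m0 /set_mem Ym] mmin.
  have rm : return_time R T Y x = m%:R%:E.
    apply: return_timeE => // j /andP[j0 jm] Yj.
    by have := mmin j; rewrite j0 mem_set// => /(_ isT); rewrite leqNgt jm.
  move: rx; rewrite rm => -[] /eqP; rewrite eqr_nat => /eqP nm; rewrite nm in Ym m0 mmin.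
  split; first by exists n.+1 => //=.
  move=> [[|j] /= jn Yj]; first exact: Yx.
  by have := mmin j.+1; rewrite mem_set// => /(_ isT); rewrite leqNgt jn.
move=> [[k /= kn Yk] h].
have nk : k = n.+1.
  by move: kn; rewrite ltnS leq_eqVlt => /predU1P[//|kn]; exfalso; apply: h; exists k.
rewrite nk in Yk; split; first by move=> Yx; apply: h; exists 0.
apply: return_timeE => // j /andP[_ jn] Yj; apply: h; exists j => //.
Qed.

Lemma measurable_level n : measurable (level R T Y n).
Proof. by rewrite levelE; apply: measurableD; exact: measurable_hitting_set. Qed.

Lemma mu_level n : mu (level R T Y n) = (w n.+1 - w n)%:E.
Proof.
rewrite levelE measureD ?mu_hitting_set -?wandering_rateE ?ltry//; try exact: measurable_hitting_set.
rewrite setIidr; last by move=> x [k /= kn Yk]; exists k => //=; exact: ltnW.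
  by rewrite EFinB !wandering_rateE -!mu_hitting_set.
by move: (ltry (w n.+1)); rewrite wandering_rateE -mu_hitting_set.
Qed.

Lemma visits_level N x : (0 < visits N x)%N ->
  exists2 k, (k <= N)%N & level R T Y k x /\ Y (iter k T x).
Proof.
move=> v0.
have ex : exists k, (k <= N)%N && (iter k T x \in Y).
  apply: contrapT => h; move: v0; rewrite lt0n => /negP; apply; apply/visits_eq0P.
  by move=> k /andP[k0 kN] Yk; apply: h; exists k; rewrite kN mem_set.
case: (ex_minnP ex) => m /andP[mN /set_mem Ym] mmin; exists m => //; split => //.
rewrite levelE; split; first by exists m => /=.
move=> [j /= jm Yj]; have := mmin j; rewrite (leq_trans (ltnW jm) mN) mem_set// => /(_ isT).
by rewrite leqNgt jm.
Qed.

(** Classify the points by the first time k at which the orbit is in Y. For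
k <= N - M, at least M steps remain after time k, during which at most J visits
occur; for larger k only the measure of the level is kept. *)
Lemma mu_few_positive_visits_le J N M : (M <= N)%N ->
  (mu [set x | (0 < visits N x <= J)%N] <=
    \sum_(k < N.+1) mu (level R T Y k `&` iter k T @^-1` (Y `&` [set x | (visits M x <= J)%N]))
    + (w N.+1 - w (N - M).+1)%:E)%E.
Proof.
move=> MN.
have mA : measurable (Y `&` [set x | (visits M x <= J)%N]).
  by apply: measurableI => //; exact: (measurable_visits _ (fun k => k <= J)%N).
set A := Y `&` _ in mA *.
pose B k := if (k <= N - M)%N then level R T Y k `&` iter k T @^-1` A else level R T Y k.
have mB k : measurable (B k).
  rewrite /B; case: ifP => _; last exact: measurable_level.
  by apply: measurableI; [exact: measurable_level|exact: measurable_iter].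
have sub : [set x | (0 < visits N x <= J)%N] `<=` \big[setU/set0]_(k < N.+1) B k.
  move=> x /= /andP[v0 vJ]; rewrite -bigcup_mkord.
  have [k kN [Lk Yk]] := visits_level v0; exists k => //=.
  rewrite /B; case: leqP => // kNM; split => //; split => //=.
  apply: leq_trans vJ; rewrite (leq_trans (@leq_visits M (N - k) _ _))//; first by lia.
  by rewrite -{2}(subnKC kN) visitsD leq_addl.
apply: (@le_trans _ _ (\sum_(k < N.+1) mu (B k))%E).
  apply: le_trans (_ : mu (\big[setU/set0]_(k < N.+1) B k) <= _)%E.
    apply: le_measure; rewrite ?inE//.
      exact: (measurable_visits _ (fun k => 0 < k <= J)%N).
    exact: bigsetU_measurable.
  exact: Boole_inequality.
have NM : ((N - M).+1 <= N.+1)%N by rewrite ltnS leq_subr.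
rewrite -(big_mkord xpredT (fun k => mu (B k))) -(big_mkord xpredT (fun k => mu (level R T Y k `&` iter k T @^-1` A))).
rewrite [in leLHS](@big_cat_nat _ _ _ (N - M).+1 0 N.+1)//= [in leRHS](@big_cat_nat _ _ _ (N - M).+1 0 N.+1)//= -addeA.
apply: leeD.
  rewrite le_eqVlt; apply/orP; left; apply/eqP/eq_big_nat => k /andP[_ kNM].
  by rewrite /B -ltnS kNM.
rewrite -(telescope_sumr _ NM) -sumEFin; rewrite -[leLHS]add0e; apply: leeD.
  by apply: sume_ge0 => k _; exact: measure_ge0.
rewrite le_eqVlt; apply/orP; left; apply/eqP/eq_big_nat => k /andP[NMk _].
by rewrite /B leqNgt NMk/= mu_level.
Qed.

(** * The bound by the transfer operator *)

Section transfer.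
Variable hT : (X -> R) -> X -> R.
Hypothesis hTP : transfer_operator mu T hT.
Hypothesis muX_gt0 : (0 < mu setT)%E.

Lemma Lfun_indic_oo A : measurable A -> (\1_A : X -> R) \in Lfun mu +oo%E.
Proof.
move=> mA; rewrite inE/=; apply/andP; split.
  by rewrite inE/=; exact: measurable_indic.
rewrite inE/= /finite_norm unlock muX_gt0; apply: (@le_lt_trans _ _ 1%:E); last exact: ltry.
apply/ess_supP; apply: nearW => x /=; rewrite lee_fin indicE.
by case: (_ \in _); rewrite ?normr1 ?normr0.
Qed.

Lemma Lfun_indic1 A : measurable A -> (mu A < +oo)%E -> (\1_A : X -> R) \in Lfun mu 1.
Proof.
move=> mA Afin; rewrite inE/=; apply/andP; split.
  by rewrite inE/=; exact: measurable_indic.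
rewrite inE/= /finite_norm Lnorm1.
rewrite (eq_integral (fun x => (\1_A x)%:E)); last first.
  by move=> x _ /=; rewrite ger0_norm.
by rewrite integral_indic// setIT.
Qed.

(** Duality is iterated on indicators only: composing an indicator with T gives
the indicator of a preimage, so that A varies in the induction. *)
Lemma transfer_iter k u A : u \in Lfun mu 1 -> measurable A ->
  iter k hT u \in Lfun mu 1 /\
  (\int[mu]_x (\1_A (iter k T x) * u x)%:E = \int[mu]_x (\1_A x * iter k hT u x)%:E)%E.
Proof.
move=> u1; elim: k A => [//|k IH] A mA.
have mTA : measurable (T @^-1` A) by exact: (measurable_iter 1).
have [L1 IHe] := IH _ mTA.
have [L2 e] := hTP L1; split => //=.
by rewrite -e; [exact: IHe|exact: Lfun_indic_oo].
Qed.

(** Duality moves all the maps T^k to the other side, where their sum is bounded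
almost everywhere by the essential supremum hypothesis. *)
Lemma sum_level_le (C : R) n A : (0 < n)%N -> 0 <= C -> measurable A ->
  (Lnorm mu +oo (fun x => ((w n)^-1 *
        \sum_(k < n) iter k hT (\1_(level R T Y k)) x)%:E) <= C%:E)%E ->
  (0 < w n) ->
  (\sum_(k < n) mu (level R T Y k `&` iter k T @^-1` A) <= (C * w n)%:E * mu A)%E.
Proof.
move=> n0 C0 mA; rewrite unlock muX_gt0 => /ess_supP hC wn.
have L1 k : (\1_(level R T Y k) : X -> R) \in Lfun mu 1.
  by apply: Lfun_indic1; rewrite ?mu_level ?ltry//; exact: measurable_level.
have int k : mu.-integrable setT (EFin \o (fun x => \1_A x * iter k hT (\1_(level R T Y k)) x)).
  have [+ _] := transfer_iter k (L1 k) mA.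
  move: (iter _ _ _) => g /andP[]; rewrite !inE/= => mg fg.
  have ig : mu.-integrable setT (EFin \o g).
    by apply/integrableP; split; [exact/measurable_EFinP|move: fg; rewrite /finite_norm Lnorm1].
  apply: (le_integrable _ _ _ ig) => //.
    by apply/measurable_EFinP; apply: measurable_funM => //; exact: measurable_indic.
  move=> x _ /=; rewrite lee_fin normrM ler_piMl// indicE.
  by case: (_ \in _); rewrite ?normr1 ?normr0.
have -> : (\sum_(k < n) mu (level R T Y k `&` iter k T @^-1` A) =
    \int[mu]_x (\1_A x * \sum_(k < n) iter k hT (\1_(level R T Y k)) x)%:E)%E.
  transitivity (\sum_(k < n) \int[mu]_x (\1_A x * iter k hT (\1_(level R T Y k)) x)%:E)%E.
    apply: eq_bigr => k _; have [_ <-] := transfer_iter k (L1 k) mA.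
    rewrite (eq_integral (fun x => (\1_(level R T Y k `&` iter k T @^-1` A) x)%:E)).
      rewrite integral_indic ?setIT//.
      by apply: measurableI; [exact: measurable_level|exact: measurable_iter].
    by move=> x _; rewrite !indicE in_setI mulrC -natrM mulnb.
  rewrite -(integral_sum measurableT (fun k : 'I_n => int k)); apply: eq_integral => x _.
  by rewrite sumEFin mulr_sumr.
have mS : measurable_fun setT (fun x => (\1_A x * \sum_(k < n) iter k hT (\1_(level R T Y k)) x)%:E).
  apply: (eq_measurable_fun (fun x => \sum_(k < n) (\1_A x * iter k hT (\1_(level R T Y k)) x)%:E)%E).
    by move=> x _; rewrite sumEFin mulr_sumr.
  by apply: emeasurable_sum => k; exact: measurable_int (int k).
apply: (le_trans (lee_abs _)); apply: (le_trans (le_abse_integral _ measurableT mS)).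
have -> : ((C * w n)%:E * mu A = \int[mu]_x `|(C * w n * \1_A x)%:E|)%E.
  rewrite (eq_integral (fun x => (C * w n)%:E * (\1_A x)%:E)%E); last first.
    by move=> x _; rewrite abse_EFin ger0_norm ?EFinM// !mulr_ge0// ltW.
  rewrite ge0_integralZl//; first by rewrite integral_indic// setIT.
  - by apply/measurable_EFinP; exact: measurable_indic.
  - by rewrite lee_fin mulr_ge0// ltW.
apply: ae_ge0_le_integral => //.
- exact: measurableT_comp.
- by apply/measurable_EFinP; apply: measurableT_comp => //; apply: measurable_funM => //; exact: measurable_indic.
apply: filterS hC => x /= hx _; rewrite lee_fin !normrM.
rewrite mulrC ler_wpM2r// (ger0_norm C0) (ger0_norm (ltW wn)).
move: hx; rewrite lee_fin normrM ger0_norm ?invr_ge0 ?(ltW wn)//.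
by rewrite mulrC ler_pdivrMr.
Qed.

Lemma sum_few_visits_ge_transfer (C : R) J N M : (0 < M <= N)%N -> 0 <= C ->
  (Lnorm mu +oo (fun x => ((w N.+1)^-1 *
        \sum_(k < N.+1) iter k hT (\1_(level R T Y k)) x)%:E) <= C%:E)%E ->
  (0 < w N.+1) ->
  J.+1%:R * (w N - C * w N.+1 * (J.+1%:R * w M / M%:R) - (w N.+1 - w (N - M).+1)) <=
  \sum_(j < N) few_visits J j.
Proof.
move=> /andP[M0 MN] C0 hC w0; apply: le_trans (sum_few_visits_ge J N).
rewrite ler_pM2l// -addrA lerD2l -opprD lerN2.
have mA : measurable (Y `&` [set x | (visits M x <= J)%N]).
  by apply: measurableI => //; exact: (measurable_visits _ (fun k => k <= J)%N).
have h1 := mu_few_positive_visits_le J MN.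
have h2 := sum_level_le (ltn0Sn N) C0 mA hC w0.
have := le_trans h1 (leeD2r _ h2); rewrite -few_visitsE -EFinM -EFinD => h3.
have fin0J : mu [set x | (0 < visits N x <= J)%N] \is a fin_num.
  by rewrite ge0_fin_numE// (le_lt_trans h3)// ltry.
move: h3; rewrite -(fineK fin0J) lee_fin => /le_trans; apply.
rewrite lerD2r ler_wpM2l ?mulr_ge0 ?(ltW w0)// ler_pdivlMr ?ltr0n//.
apply: le_trans (sum_few_visits_le J M).
rewrite mulr_natr -[in X in _ *+ X](card_ord M) -sumr_const; apply: ler_sum => j _.
by apply: noninc_leq; [exact: few_visits_noninc|exact: ltnW].
Qed.
End transfer.
End visits.

(** * The norming function and the constant *)

Lemma mu_density_occupation (d : measure_display) (X : measurableType d) (R : realType)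
  (mu : {measure set X -> \bar R}) (T : X -> X) (Y : set X) (n : nat) (b c : R) :
  measurable_fun setT T -> measurable Y -> (mu Y < +oo)%E -> 0 < b -> 0 <= c ->
  mu_density mu \1_Y [set x | occupation T Y n x / b <= c] =
    (few_visits mu T Y (Num.truncn (c * b)) n)%:E.
Proof.
move=> mT mY muY_fin b0 c0; rewrite few_visitsE// /mu_density.
have -> : [set x | occupation T Y n x / b <= c] =
    [set x | (visits T Y n x <= Num.truncn (c * b))%N].
  by apply/seteqP; split => x /=; rewrite occupationE ler_pdivrMr// truncn_ge_nat// mulr_ge0// ltW.
rewrite integral_indic//; exact: (measurable_visits mT mY _ (fun k => k <= Num.truncn (c * b))%N).
Qed.

Section norming_asymptotics.
Context {d : measure_display} {X : measurableType d} {R : realType}.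
Variables (mu : {measure set X -> \bar R}) (T : X -> X) (Y : set X) (alpha : R) (ell : R -> R).
Hypotheses (alpha_gt0 : 0 < alpha) (alpha_lt1 : alpha < 1).
Hypothesis svell : slowly_varying ell.
Local Notation Q := (Qlaplace mu T Y).
Hypothesis Q_cvg : forall t : nat -> R, t n @[n --> \oo] --> +oo ->
  Q (t n)^-1 / (t n `^ (1 - alpha) * ell (t n)) @[n --> \oo] --> Gamma (2 - alpha).

Let s := sin (pi * alpha) / (pi * alpha).

Lemma reflection_neq0 : [/\ Gamma (1 + alpha) != 0, Gamma (2 - alpha) != 0 & s != 0].
Proof.
have := Gamma_reflection (x := alpha); rewrite alpha_gt0 alpha_lt1 -/s => /(_ isT) h.
have : Gamma (1 + alpha) * Gamma (2 - alpha) * s != 0 by rewrite h subr_eq0 gt_eqF.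
by rewrite !mulf_eq0 !negb_or => /andP[/andP[]].
Qed.

Lemma norming_cvg : asymp_equiv (pinfty_nbhs R) (norming mu T Y alpha)
  (fun t => t `^ alpha / (Gamma (1 + alpha) * Gamma (2 - alpha) * ell t)).
Proof.
have [g1 g2 _] := reflection_neq0.
apply/cvg_pinftyP => t too.
have := cvgnZ (b := Gamma (2 - alpha)) (cvgnV g2 (Q_cvg too)); rewrite divff//.
apply: cvgn_eq; near=> n.
have t0 : 0 < t n by near: n; apply: cvgry_gt.
have e0 : ell (t n) != 0 by rewrite gt_eqF// (slowly_varying_gt0 svell).
have p0 : t n `^ alpha != 0 by rewrite gt_eqF// powR_gt0.
have tE : t n = t n `^ alpha * t n `^ (1 - alpha).
  rewrite -powRD; first by rewrite addrC subrK powRr1// ltW.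
  by apply/implyP => _; rewrite gt_eqF.
rewrite /norming [X in _ = X / _ / _]tE.
have p1 : t n `^ (1 - alpha) != 0 by rewrite gt_eqF// powR_gt0.
move: (Gamma _) (Gamma _) (ell _) (_ `^ _) (_ `^ _) (Q _) g1 g2 e0 p0 p1 => a b c e f g a0 b0 c0 e0 f0.
have [->|g0] := eqVneq g 0; first by rewrite mulr0 mul0r !invr0 !mulr0 mul0r.
by field; rewrite a0 b0 c0 e0 f0 g0.
Unshelve. all: by end_near. Qed.

Variable w : nat -> R.
Hypothesis w_cvg : asymp_equiv \oo w (fun n => n%:R `^ (1 - alpha) * ell n%:R).
Local Notation a := (norming mu T Y alpha).
Variable c : nat -> R.
Hypotheses (c0 : forall n, 0 < c n) (ca_pinfty : c n * a n%:R @[n --> \oo] --> +oo).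
Let J n := Num.truncn (c n * a n%:R).

(** The norming function is t / (Gamma (1 + alpha) Q (1/t)), so the powers of n
cancel and only w and Q, both regularly varying with the same ell, remain. *)
Lemma truncn_norming_cvg : (J n).+1%:R * w n / n%:R / c n @[n --> \oo] -->
  (Gamma (1 + alpha) * Gamma (2 - alpha))^-1.
Proof.
have [g1 g2 _] := reflection_neq0.
have JE : (J n).+1%:R / (c n * a n%:R) @[n --> \oo] --> (1 : R).
  have := cvgnD (cvgy_trunc ca_pinfty) (cvgn_inv ca_pinfty); rewrite addr0.
  by apply: cvgn_eq; apply: nearW => n; rewrite /J -natr1 mulrDl mul1r.
have := cvgnM JE (cvgnZ (b := (Gamma (1 + alpha))^-1)
  (cvgnM w_cvg (cvgnV g2 (Q_cvg (@cvg_natr_pinfty R))))).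
rewrite !mul1r -invfM; apply: cvgn_eq; near=> n.
have n0 : n%:R != 0 :> R by rewrite pnatr_eq0 -lt0n; near: n; exact: nbhs_infty_gt.
have ca0 : c n * a n%:R != 0 by rewrite gt_eqF//; near: n; apply: cvgry_gt.
have r0 : n%:R `^ (1 - alpha) * ell n%:R != 0.
  by rewrite gt_eqF// mulr_gt0 ?powR_gt0 ?(slowly_varying_gt0 svell)// lt0r n0 ler0n.
have cn0 : c n != 0 by rewrite gt_eqF.
move: ca0; rewrite mulf_eq0 (negbTE cn0)/= /norming.
move: (n%:R : R) (Gamma (1 + alpha)) (_ `^ _ * ell _) (Q _) ((J n).+1%:R) (c n) (w n) n0 g1 r0 cn0.
move=> m g rr QQ j cc ww m0 g0 r0 c0'.
have [->|Q0] := eqVneq QQ 0; first by rewrite mulr0 invr0 mulr0 eqxx.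
by move=> _; field; rewrite g0 r0 Q0 m0 c0'.
Unshelve. all: by end_near. Qed.

Lemma equiv_sin_cvg (F : nat -> R) (q := fun n => (J n).+1%:R * w n / n%:R) :
  (forall n, (0 < n)%N -> 0 < w n) ->
  F n / q n @[n --> \oo] --> 1 - alpha -> asymp_equiv \oo F (fun n => s * c n).
Proof.
move=> w0 Fq; have [g1 g2 s0] := reflection_neq0.
have := cvgnZ (b := s^-1) (cvgnM Fq truncn_norming_cvg).
have -> : s^-1 * ((1 - alpha) * (Gamma (1 + alpha) * Gamma (2 - alpha))^-1) = 1.
  rewrite -Gamma_reflection ?alpha_gt0// -/s; move: g1 g2 s0.
  move: (Gamma _) (Gamma _) s => b b' e b0 b'0 e0; field; by rewrite b0 b'0 e0.
apply: cvgn_eq; near=> n.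
have n0 : (0 < n)%N by near: n; exact: nbhs_infty_gt.
have qn0 : q n != 0 by rewrite gt_eqF// divr_gt0 ?ltr0n// mulr_gt0 ?ltr0n// w0.
have cn0 : c n != 0 by rewrite gt_eqF.
rewrite -/(q n); move: (F n) (q n) (c n) s qn0 cn0 s0 => f1 f2 f3 f4 b1 b2 b3.
by field; rewrite b1 b2 b3.
Unshelve. all: by end_near. Qed.
End norming_asymptotics.

Theorem theorem3p9 (d : measure_display) (X : measurableType d) (R : realType)
  (mu : {sigma_finite_measure set X -> \bar R}) (T : X -> X) (Y : set X)
  (hT : (X -> R) -> X -> R) (alpha : R) (ell : R -> R)
  (muX : mu setT = +oo%E)
  (mY : measurable Y) (muY_gt0 : (0 < mu Y)%E) (muY_fin : (mu Y < +oo)%E)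
  (cemptT : CEMPT mu T)
  (hTP : transfer_operator mu T hT)
  (alpha_gt0 : 0 < alpha) (alpha_lt1 : alpha < 1)
  (svell : slowly_varying ell)
  (wY : asymp_equiv \oo (wandering_rate mu T Y)
          (fun n => n%:R `^ (1 - alpha) * ell n%:R))
  (bdd : exists C : R, forall n, (0 < n)%N ->
     (Lnorm mu +oo (fun x => ((wandering_rate mu T Y n)^-1 *
        \sum_(k < n) iter k hT (\1_(level R T Y k)) x)%:E) <= C%:E)%E) :
  let a := norming mu T Y alpha in
  asymp_equiv (pinfty_nbhs R) a
    (fun t => t `^ alpha / (Gamma (1 + alpha) * Gamma (2 - alpha) * ell t)) /\
  forall c : nat -> R,
    (forall n, 0 < c n) ->
    c n @[n --> \oo] --> (0 : R) ->
    (c n * a n%:R) @[n --> \oo] --> +oo ->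
    asymp_equiv \oo
      (fun n => fine (mu_density mu \1_Y [set x | occupation T Y n x / a n%:R <= c n]))
      (fun n => sin (pi * alpha) / (pi * alpha) * c n).
Proof.
move=> a.
have mT := CEMPT_measurable cemptT; have muT := CEMPT_preserving cemptT.
set w := wandering_rate mu T Y in wY bdd.
have w0 : w 0 = 0 by exact: wandering_rate0.
have vE n : w n.+1 - w n = few_visits mu T Y 0 n by exact: wandering_rate_diff.
have v_ge0 n : 0 <= w n.+1 - w n by rewrite vE few_visits_ge0.
have v_dec n : w n.+2 - w n.+1 <= w n.+1 - w n by rewrite !vE few_visits_noninc.
have w1 : 0 < w 1.
  have := vE 0; rewrite w0 subr0 => ->; rewrite -lte_fin few_visitsE//.
  by rewrite (_ : [set x | _] = setT) ?setIT//; apply/seteqP; split.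
have wgt n : (0 < n)%N -> 0 < w n by exact: concave_seq_gt0.
have Q_cvg (t : nat -> R) : t n @[n --> \oo] --> +oo ->
    Qlaplace mu T Y (t n)^-1 / (t n `^ (1 - alpha) * ell (t n)) @[n --> \oo] --> Gamma (2 - alpha).
  by move=> too; exact: (laplace_cvg svell alpha_lt1 wY w0 v_ge0 v_dec w1 too).
split; first exact: norming_cvg.
move=> c c0 cto0 caoo.
have muX0 : (0 < mu setT)%E by rewrite muX.
have [C hC] := bdd.
have C0 : 0 <= C.
  have := hC 1 isT; apply: contraTT; rewrite -!ltNge => C0.
  by rewrite (@lt_le_trans _ _ 0%E) ?lte_fin// Lnorm_ge0.
pose J n := Num.truncn (c n * a n%:R).
have q0 : (J n).+1%:R * w n / n%:R @[n --> \oo] --> (0 : R).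
  have := cvgnM (truncn_norming_cvg alpha_gt0 alpha_lt1 svell Q_cvg wY c0 caoo) cto0.
  rewrite mulr0; apply: cvgn_eq; apply: nearW => n.
  by rewrite divfK// gt_eqF.
have F_cvg : few_visits mu T Y (J n) n / ((J n).+1%:R * w n / n%:R) @[n --> \oo] --> 1 - alpha.
  apply: (monotone_density svell alpha_gt0 alpha_lt1 wY v_ge0 w1 C0 _ _ _ q0).
  - by move=> J' j; exact: few_visits_noninc.
  - by move=> J' N; exact: sum_few_visits_le.
  - move=> J' N M MN; have h := sum_few_visits_ge_transfer mT muT mY muY_fin hTP muX0 J' MN C0.
    exact: h (hC N.+1 isT) (wgt N.+1 isT).
have := equiv_sin_cvg alpha_gt0 alpha_lt1 svell Q_cvg wY c0 caoo wgt F_cvg.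
apply: cvgn_eq; near=> n.
have ca0 : 0 < c n * a n%:R by near: n; apply: cvgry_gt.
have a0 : 0 < a n%:R by move: ca0; rewrite pmulr_rgt0.
by rewrite mu_density_occupation// ltW.
Unshelve. all: by end_near. Qed.
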